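(* Let $G$ be a real reductive Lie group, let $\pi$ be in $\mathrm{Rep}^{\infty,F}(G)$, let $P$ be a parabolic subgroup of $G$ with unipotent radical $N_P$, and let $\mathfrak n=\mathrm{Lie}(N_P)$. Put $\mathbf{CJ}^{\infty}_{s,P}(\pi)=\bigcap_{k\ge 0}\overline{\mathfrak n^k.\pi}$. For each integer $k\geq 1$, let $x_k$ be an element of $\overline{\mathfrak n^k.\pi}/\mathbf{CJ}^{\infty}_{s,P}(\pi)\subset \pi/\mathbf{CJ}^{\infty}_{s,P}(\pi)$. Then the sequence $(x_k)_{k\ge 1}$ converges to $0$ in $\pi/\mathbf{CJ}^{\infty}_{s,P}(\pi)$ (with its quotient topology).
   Context: Fix an algebraic scale $\|\cdot\|_G$ on $G$, e.g. $\|g\|_G=\mathrm{tr}(\rho(g)\rho(g)^* )+\mathrm{tr}(\rho(g^{-1})\rho(g^{-1})^* )$ for a finite-dimensional representation $\rho$ of $G$ with finite kernel and closed image. $\mathrm{Rep}^{\infty,F}(G)$ is the category of smooth Fréchet representations of $G$ of moderate growth: complex Fréchet spaces $\pi$ with a continuous linear action $G\times\pi\to\pi$ such that every orbit map $g\mapsto g.v$ is smooth and such that for every continuous seminorm $p_1$ on $\pi$ there are an integer $r\ge 0$ and a continuous seminorm $p_2$ on $\pi$ with $p_1(g.v)\le \|g\|_G^r\,p_2(v)$ for all $g\in G$, $v\in\pi$; morphisms are continuous $G$-equivariant linear maps. $\mathfrak n^k.\pi$ is the linear span of all $X_1\cdots X_k.v$ with $X_i\in\mathfrak n$, $v\in\pi$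 (and $\mathfrak n^0.\pi=\pi$); closures are taken in $\pi$. *)

(* Defs.v *)
From HB Require Import structures.
From mathcomp Require Import all_boot all_order all_algebra.
From mathcomp Require Import all_classical all_reals all_analysis.
From mathcomp Require Import complex.
From mathcomp Require mpoly.

Set Implicit Arguments.
Unset Strict Implicit.
Unset Printing Implicit Defensive.

Import Order.TTheory GRing.Theory Num.Theory.
Import numFieldTopology.Exports numFieldNormedType.Exports.

Local Open Scope classical_set_scope.
Local Open Scope complex_scope.
Local Open Scope ring_scope.
Local Open Scope quotient_scope.

HB.mixin Record isTopologicalGroup G & Group G & Topological G := {
  mulg_continuous : continuous (fun xy : G * G => (xy.1 * xy.2)%g);
  invg_continuous : continuous (fun x : G => (x^-1)%g)
}.

#[short(type="topologicalGroupType")]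
HB.structure Definition TopologicalGroup :=
  {G of isTopologicalGroup G & Group G & Topological G}.

Definition is_subgroup (G : groupType) (H : set G) : Prop :=
  [/\ H 1%g, forall x y, H x -> H y -> H (x * y)%g & forall x, H x -> H (x^-1)%g].

Definition lspan (K : nzRingType) (V : lmodType K) (A : set V) : set V :=
  [set v | exists (m : nat) (c : 'I_m -> K) (w : 'I_m -> V),
    (forall i, A (w i)) /\ v = \sum_i c i *: w i].

Section LieMatrices.
Context (K : fieldType) (n : nat).
Implicit Types (g h b : set 'M[K]_n).

Definition lie_bracket (A B : 'M[K]_n) : 'M[K]_n := A *m B - B *m A.

Definition lie_subalgebra h : Prop :=
  [/\ h 0,
      forall a A B, h A -> h B -> h (a *: A + B)
    & forall A B, h A -> h B -> h (lie_bracket A B)].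

Fixpoint derived_series h (k : nat) : set 'M[K]_n :=
  if k is k'.+1 then
    lspan [set lie_bracket A B | A in derived_series h k' & B in derived_series h k']
  else h.

Definition lie_solvable h : Prop := exists k, derived_series h k `<=` [set 0].

Definition borel_subalgebra g b : Prop :=
  [/\ lie_subalgebra b, b `<=` g, lie_solvable b
    & forall b', lie_subalgebra b' -> b' `<=` g -> lie_solvable b' ->
        b `<=` b' -> b' = b].

End LieMatrices.

Definition complexification (R : realType) (n : nat) (h : set 'M[R]_n) :
    set 'M[R[i]]_n :=
  lspan [set map_mx (fun a : R => a%:C) X | X in h].

(* p is parabolic when its complexification contains a Borel (maximal solvable)
   subalgebra of the complexification of g. *)
Definition parabolic_subalgebra (R : realType) (n : nat) (g p : set 'M[R]_n) : Prop :=
  [/\ lie_subalgebra p, p `<=` g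
    & exists2 b, borel_subalgebra (complexification g) b & b `<=` complexification p].

(* Real points of the algebraic subset of GL_n cut out by the real polynomials
   in S; the n * n variables are the matrix entries. *)
Definition algebraic_locus (R : realType) (n : nat)
    (S : set (mpoly.mpoly (n * n) R)) : set 'M[R]_n :=
  [set g | g \in unitmx /\
    forall f, S f -> mpoly.meval (fun k => mxvec g 0 k) f = 0].

Section ReductiveGroup.
Context (R : realType) (n : nat) (G : topologicalGroupType) (rho : G -> 'M[R]_n).

Definition symmetric_algebraic_group (H : set 'M[R]_n) : Prop :=
  [/\ exists S, H = algebraic_locus S,
      H 1%:M,
      forall g h, H g -> H h -> H (g *m h),
      forall g, H g -> H (invmx g)
    & forall g, H g -> H g^T].

(* Real reductive groups in the sense of Wallach: rho is a finite covering of an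
   open subgroup of a group H of real points of an algebraic group stable under
   transposition.  A continuous open homomorphism with finite kernel from a
   Hausdorff group is a finite covering of its image.  The Lie group structure
   of G is the one for which rho is a local diffeomorphism onto the closed
   subgroup rho(G) of GL_n(R). *)
Definition real_reductive : Prop :=
  [/\ hausdorff_space G,
      continuous rho,
      rho 1%g = 1%:M /\ (forall x y, rho (x * y)%g = rho x *m rho y),
      finite_set [set x | rho x = 1%:M]
    & exists2 H, symmetric_algebraic_group H &
        forall U : set G, open U ->
          exists2 W : set 'M[R]_n, open W & rho @` U = W `&` H].

(* An element of the Lie algebra of a closed subgroup H is given by its
   one-parameter subgroup. *)
Definition lie_algebra (H : set G) : set (R -> G) :=
  [set gamma | [/\ continuous gamma,
    forall s t, gamma (s + t) = (gamma s * gamma t)%g & forall t, H (gamma t)]].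

Definition lie_algebra_mx (H : set G) : set 'M[R]_n :=
  [set X | exists2 gamma, lie_algebra H gamma &
    t^-1 *: (rho (gamma t) - 1%:M) @[t --> (0 : R)^'] --> X].

(* Normalizers in G of parabolic subalgebras of Lie(G), both seen in the matrix
   algebra through rho. *)
Definition parabolic_subgroup (P : set G) : Prop :=
  exists2 p, parabolic_subalgebra (lie_algebra_mx setT) p &
    P = [set g | [set rho g *m X *m invmx (rho g) | X in p] = p].

(* Unipotence in G is that of the algebraic group containing rho(G). *)
Definition normal_unipotent (P N : set G) : Prop :=
  [/\ is_subgroup N, N `<=` P, closed N, connected N
    & (forall g x, P g -> N x -> N (g * x * g^-1)%g) /\
      (forall x, N x -> exists k, (rho x - 1%:M) ^+ k = 0)].

Definition unipotent_radical (P N : set G) : Prop :=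
  normal_unipotent P N /\ forall N', normal_unipotent P N' -> N' `<=` N.

Definition rho_scale (g : G) : R :=
  \tr (rho g *m (rho g)^T) + \tr (rho g^-1%g *m (rho g^-1%g)^T).

(* The algebraic scales of G are the functions polynomially equivalent to
   tr(rho(g) rho(g)^* ) + tr(rho(g^-1) rho(g^-1)^* ). *)
Definition algebraic_scale (s : G -> R) : Prop :=
  [/\ forall g, 0 <= s g,
      exists (C : R) (r : nat), forall g, s g <= C * rho_scale g ^+ r
    & exists (C : R) (r : nat), forall g, rho_scale g <= C * s g ^+ r].

End ReductiveGroup.

Section Representation.
Context (R : realType) (E : tvsType R[i]).

(* Completeness is that of the additive uniformity, which the uniform structure
   carried by a tvsType need not be. *)
Definition frechet : Prop :=
  [/\ hausdorff_space E,
      exists B : nat -> set E, (forall i, nbhs 0 (B i)) /\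
        (forall U, nbhs (0 : E) U -> exists i, B i `<=` U)
    & forall u : nat -> E,
        u ij.1 - u ij.2 @[ij --> (\oo, \oo)] --> (0 : E) ->
        exists l : E, u @ \oo --> l].

Definition continuous_seminorm (p : E -> R) : Prop :=
  [/\ continuous p,
      forall v, 0 <= p v,
      forall u v, p (u + v) <= p u + p v
    & forall (c : R[i]) v, p (c *: v) = ComplexField.Normc.normc c * p v].

(* C^k maps on an open set W, in terms of directional derivatives. *)
Fixpoint Ck (n k : nat) (W : set 'M[R]_n) (F : 'M[R]_n -> E) : Prop :=
  (forall x, W x -> {for x, continuous F}) /\
  if k is k'.+1 then
    exists dF : 'M[R]_n -> 'M[R]_n -> E, forall h,
      (forall x, W x ->
        (t^-1)%:C *: (F (x + t *: h) - F x) @[t --> (0 : R)^'] --> dF h x) /\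
      Ck k' W (dF h)
  else True.

Definition smooth_on (n : nat) (W : set 'M[R]_n) (F : 'M[R]_n -> E) : Prop :=
  forall k, Ck k W F.

(* Smoothness on G, with rho a local diffeomorphism onto a closed submanifold of
   the space of matrices: locally, a smooth function of the matrix rho(g). *)
Definition smooth_map (n : nat) (G : topologicalType) (rho : G -> 'M[R]_n)
    (f : G -> E) : Prop :=
  forall g, exists U W F, [/\ open U, U g, open W, smooth_on W F
    & forall h, U h -> W (rho h) /\ f h = F (rho h)].

Context (G : topologicalGroupType) (act : G -> E -> E).

Definition continuous_representation : Prop :=
  [/\ forall v, act 1%g v = v,
      forall g h v, act (g * h)%g v = act g (act h v),
      forall g (c : R[i]) u v, act g (c *: u + v) = c *: act g u + act g v
    & continuous (fun gv : G * E => act gv.1 gv.2)].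

Definition moderate_growth (s : G -> R) : Prop :=
  forall p1, continuous_seminorm p1 ->
    exists (r : nat) (p2 : E -> R), continuous_seminorm p2 /\
      forall g v, p1 (act g v) <= s g ^+ r * p2 v.

Definition smooth_frechet_representation (n : nat) (rho : G -> 'M[R]_n)
    (s : G -> R) : Prop :=
  [/\ frechet, continuous_representation,
      forall v, smooth_map rho (fun g => act g v) & moderate_growth s].

(* w = X.v for X in Lie(G) with one-parameter subgroup gamma *)
Definition lie_act (gamma : R -> G) (v w : E) : Prop :=
  (t^-1)%:C *: (act (gamma t) v - v) @[t --> (0 : R)^'] --> w.

Fixpoint lie_words (n : set (R -> G)) (k : nat) : set E :=
  if k is k'.+1 then
    [set w | exists X v, [/\ n X, lie_words n k' v & lie_act X v w]]
  else setT.

(* n^k.pi *)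
Definition lie_power (n : set (R -> G)) (k : nat) : set E := lspan (lie_words n k).

(* CJ_{s,P}^oo(pi), for n the Lie algebra of the unipotent radical N of P *)
Definition CJ (N : set G) : set E :=
  \bigcap_(k in [set: nat]) closure (lie_power (lie_algebra N) k).

Lemma lspan_sub (A : set E) u v : lspan A u -> lspan A v -> lspan A (u - v).
Proof.
move=> [m [c [w [Aw ->]]]] [m' [c' [w' [Aw' ->]]]].
exists (m + m')%N,
  (fun i => match fintype.split i with inl j => c j | inr j => - c' j end),
  (fun i => match fintype.split i with inl j => w j | inr j => w' j end).
split=> [i|]; first by case: (fintype.split i).
rewrite big_split_ord/= -sumrN; congr (_ + _); apply: eq_bigr => i _.
  by have -> : fintype.split (lshift m' i) = inl i by exact: (unsplitK (inl i)).
have -> : fintype.split (rshift m i) = inr i by exact: (unsplitK (inr i)).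
by rewrite scaleNr.
Qed.

Lemma lspan0 (A : set E) : lspan A 0.
Proof.
exists 0%N, (fun=> 0), (fun=> 0); split; first by case.
by rewrite big_ord0.
Qed.

Lemma closure_sub (A : set E) :
  (forall u v, A u -> A v -> A (u - v)) ->
  forall u v, closure A u -> closure A v -> closure A (u - v).
Proof.
move=> AB u v Au Av U Uuv.
have [[/= U1 U2] [U1u U2v] UU] := @sub_continuous E (u, v) U Uuv.
have [a [Aa U1a]] := Au _ U1u; have [b [Ab U2b]] := Av _ U2v.
by exists (a - b); split; [exact: AB|exact: (UU (a, b))].
Qed.

Definition CJ_pred (N : set G) : {pred E} := [pred v | `[< CJ N v >]].

Lemma CJ_zmod_closed (N : set G) : zmod_closed (CJ_pred N).
Proof.
split=> [|u v /asboolP Nu /asboolP Nv]; apply/asboolP => k _.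
  by apply: subset_closure; exact: lspan0.
by apply: closure_sub => //; [exact: lspan_sub|exact: Nu|exact: Nv].
Qed.

HB.instance Definition _ (N : set G) :=
  GRing.isZmodClosed.Build E (CJ_pred N) (CJ_zmod_closed N).

(* pi / CJ(pi) with its quotient topology *)
Definition CJ_quotient (N : set G) : topologicalType :=
  quotient_topology (Quotient.quot (CJ_pred N)).

Definition CJ_pi (N : set G) (v : E) : CJ_quotient N :=
  \pi_(Quotient.quot (CJ_pred N)) v.

End Representation.

(* Main.v *)
Require Import Defs.
From mathcomp Require Import all_boot all_order all_algebra.
From mathcomp Require Import all_classical all_reals all_analysis.
From mathcomp Require Import complex ring lra zify.

(** Write [V k] for the closure of [n^k.pi].  An element [g = exp X] of [N]
    satisfies [(g - 1) V k] included in [V (k+1)], because the orbit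
    [t |-> exp (tX) v] has its derivative in [V (k+1)].
    By Kolchin's theorem the product of any factors [rho g - 1], [g] in [N],
    vanishes as soon as their number exceeds the size of the matrices, so
    [||g_1^m ... g_J^m||] is bounded by a power of [m] whose exponent does not
    depend on [J].  By moderate growth, for a continuous seminorm
    [p] there is [D], independent of [J], such that
    [p ((g_1^m - 1) ... (g_J^m - 1) v) = O (m^D)].  Modulo [V (J+1)] the vector
    inside is [m^J (g_1 - 1) ... (g_J - 1) v]; dividing by [m^J] with [J > D]
    shows by downward induction on [J] that [V J] is in the [p]-closure of every
    [V k].  So for each [p] some [V K] is in the [p]-closure of every [V k], and
    a Mittag-Leffler argument in the complete space [pi] puts [V K] in the
    [p]-closure of the intersection of the [V k]: a sequence with terms in the
    [V k] modulo that intersection is eventually [p]-null. *)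

Set Implicit Arguments.
Unset Strict Implicit.
Unset Printing Implicit Defensive.

Import Order.TTheory GRing.Theory Num.Theory.
Import numFieldTopology.Exports numFieldNormedType.Exports.
Local Open Scope classical_set_scope.
Local Open Scope complex_scope.
Local Open Scope ring_scope.

Local Notation normc := ComplexField.Normc.normc.

(** * Kolchin's theorem *)

(** In the factorization [e = C R] through the rank, idempotence cancels down to [R C = 1], and
    [tr (C R) = tr (R C)]. *)
Lemma mxtrace_idempotent (F : fieldType) n (e : 'M[F]_n) :
  e *m e = e -> \tr e = (\rank e)%:R.
Proof.
move=> ee.
have RC : row_base e *m col_base e = 1%:M.
  apply: (row_full_inj (col_base_full e)).
  apply: (row_free_inj (row_base_free e)).
  by rewrite mulmx1 mulmxA mulmx_base -mulmxA mulmx_base ee.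
by rewrite -{1}(mulmx_base e) mxtrace_mulC RC mxtrace1.
Qed.

(** Induction on the size. Writing [a = C R] through its rank, [R C] has the same trace, is still
    nilpotent, and is smaller unless [a] is invertible; an invertible nilpotent matrix has size
    0. *)
Lemma mxtrace_nilpotent (F : fieldType) n (a : 'M[F]_n) k :
  a ^+ k = 0 -> \tr a = 0.
Proof.
elim/ltn_ind: n => n IH in a k *; move=> ak0.
have [rn|rn] := ltnP (\rank a) n; last first.
  have ua : a \in unitmx by rewrite -row_free_unit -row_leq_rank.
  have : a ^+ k \in unitmx.
    by elim: (k) => [|j IHj]; rewrite ?expr0 ?unitmx1 // exprS unitmx_mul ua.
  rewrite ak0; case: n {IH rn ua ak0} a => [a _|n a].
    by rewrite (flatmx0 a) mxtrace0.
  by rewrite unitmxE det0 unitr0.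
rewrite -(mulmx_base a) mxtrace_mulC; apply: (IH _ rn _ k.+1).
have E (B : 'M[F]_(mxrank a, n)) (C : 'M[F]_(n, mxrank a)) j : C *m B = a ->
    (B *m C) ^+ j.+1 = B *m a ^+ j *m C.
  move=> CB; elim: j => [|j IHj]; first by rewrite expr1 expr0 mulmx1.
  rewrite exprS IHj exprS -[LHS]/((B *m C) *m _) -[a * _]/(a *m _).
  by rewrite !mulmxA -(mulmxA B C B) CB.
by rewrite (E _ _ _ (mulmx_base a)) ak0 mulmx0 mul0mx.
Qed.

Section NilAlgebra.
Context (F : fieldType) (n : nat) (I : {vspace 'M[F]_n}).

(* [w a I = w I] would give [w a = w a b] with [b] in [I], that is nilpotent. *)
Lemma dim_nil_mulmx (w : 'rV[F]_n) (a : 'M[F]_n) :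
    (forall a b, a \in I -> b \in I -> a *m b \in I) ->
    (forall a, a \in I -> exists k, a ^+ k = 0) ->
  a \in I -> w *m a != 0 ->
  (\dim (linfun (mulmx (w *m a)) @: I) < \dim (linfun (mulmx w) @: I))%N.
Proof.
move=> IM Inil Ia wa0.
have sub : (linfun (mulmx (w *m a)) @: I <= linfun (mulmx w) @: I)%VS.
  apply/subvP => _ /memv_imgP[b Ib ->]; apply/memv_imgP.
  by exists (a *m b); [exact: IM|rewrite !lfunE /= mulmxA].
rewrite ltn_neqAle dimvS // andbT; apply: contra wa0 => dimE.
have eqI : (linfun (mulmx (w *m a)) @: I == linfun (mulmx w) @: I)%VS.
  by rewrite eqEdim sub (eqP dimE) /=.
have : w *m a \in (linfun (mulmx w) @: I)%VS.
  by apply/memv_imgP; exists a; rewrite ?lfunE.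
rewrite -(eqP eqI) => /memv_imgP[b Ib]; rewrite lfunE /= => wab.
have [k bk] := Inil _ Ib.
have -> : w *m a = w *m a *m b ^+ k.
  elim: (k) => [|j IHj]; first by rewrite expr0 mulmx1.
  by rewrite exprS mulmxA -wab.
by rewrite bk mulmx0.
Qed.

(** Starting from a row vector [w], each factor that does not kill the current vector strictly
    lowers the dimension of [w I]. This dimension is at most [n], so a nonzero product has at most
    [n] factors. *)
Lemma prod_nil_algebra (l : seq 'M[F]_n) :
    (forall a b, a \in I -> b \in I -> a *m b \in I) ->
    (forall a, a \in I -> exists k, a ^+ k = 0) ->
  all (mem I) l -> (n < size l)%N -> \prod_(a <- l) a = 0.
Proof.
move=> IM Inil lI nl.
have key l' (w : 'rV[F]_n) : all (mem I) l' -> w *m (\prod_(a <- l') a) != 0 ->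
    (size l' <= \dim (linfun (mulmx w) @: I))%N.
  elim: l' w => //= a l' IH w /andP[aI l'I]; rewrite big_cons mulmxA => nz.
  have wa0 : w *m a != 0 by apply: contra nz => /eqP ->; rewrite mul0mx.
  exact: leq_ltn_trans (IH _ l'I nz) (dim_nil_mulmx IM Inil aI wa0).
apply/row_matrixP => i; rewrite row0 rowE; apply/eqP; apply: contraTT nl => nz.
rewrite -leqNgt (leq_trans (key _ _ lI nz)) // (leq_trans (dimvS (subvf _))) //.
by rewrite dimvf (eq_leq (etrans (dim_matrix F 1 n) (mul1n n))).
Qed.

End NilAlgebra.

(* The trace kills the Fitting idempotent of [a], which is a polynomial in [a]
   without constant term and hence lies in [I]. *)
Lemma mxtrace0_nilpotent (F : numFieldType) n (I : {vspace 'M[F]_n})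
    (a : 'M[F]_n) :
    (forall a b, a \in I -> b \in I -> a *m b \in I) ->
    (forall a, a \in I -> \tr a = 0) ->
  a \in I -> exists k, a ^+ k = 0.
Proof.
case: n => [|n] in I a *; first by move=> *; exists 0%N; apply/matrixP => -[].
move=> IM trI aI.
have [m [q q0 pE]] := multiplicity_XsubC (char_poly a) 0.
have {}q0 : ~~ root q 0 by move: q0; rewrite -size_poly_eq0 size_char_poly.
have qX : coprimep q ('X ^+ m.+1).
  by apply: coprimep_expr; rewrite -['X]subr0 coprimep_XsubC.
have /Bezout_eq1_coprimepP[[u v] /= uv] := qX.
have hI p : horner_mx a ('X * p) \in I.
  rewrite mulrC; elim/poly_ind: p => [|p c IH].
    by rewrite mul0r rmorph0 mem0v.
  rewrite mulrDl rmorphD /= memvD //.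
    by rewrite rmorphM /= horner_mx_X; exact: IM.
  by rewrite mul_polyC horner_mxZ horner_mx_X memvZ.
have hq0 : horner_mx a (q * 'X^m) = 0.
  by have := Cayley_Hamilton a; rewrite pE subr0.
(* By Bezout this polynomial is 0 modulo ['X^m] and 1 modulo [q], hence the projector onto the part
   where [a] is invertible. The exponent [m.+1] keeps its constant term 0 even when [m = 0]. *)
pose e := horner_mx a (v * 'X^(m.+1)).
have eI : e \in I by rewrite /e exprS mulrCA hI.
have ee : e *m e = e.
  apply/eqP; rewrite -subr_eq0 -[e *m e]/(e * e) /e -rmorphM -rmorphB /=.
  have -> : v * 'X^(m.+1) * (v * 'X^(m.+1)) - v * 'X^(m.+1) =
      - (v * 'X * u) * (q * 'X^m).
    rewrite -[X in _ - X]mulr1 -uv exprS; ring.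
  by rewrite rmorphM /= hq0 mulr0.
have e0 : e = 0.
  have /eqP := trI _ eI; rewrite mxtrace_idempotent //.
  by rewrite pnatr_eq0 mxrank_eq0 => /eqP.
exists m.+1; have -> : a ^+ m.+1 = horner_mx a 'X^(m.+1).
  by rewrite rmorphXn /= horner_mx_X.
have -> : 'X^(m.+1) = 'X * u * (q * 'X^m) + 'X^(m.+1) * (v * 'X^(m.+1)).
  by rewrite -[LHS]mulr1 -uv exprS; ring.
by rewrite rmorphD /= [X in X + _]rmorphM /= hq0 [X in _ + X]rmorphM /= -/e e0
  !mulr0 addr0.
Qed.

Section UnipotentMonoid.
Context (F : numFieldType) (n : nat) (S : set 'M[F]_n).

(** The span of the possibly infinite family of all [g - 1], obtained from a finite subfamily whose
    span has maximal dimension: one more element cannot enlarge it. *)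
Lemma augmentation_vspace : exists2 I : {vspace 'M[F]_n},
  (forall g, S g -> g - 1 \in I) &
  (forall U : {vspace 'M[F]_n}, (forall g, S g -> g - 1 \in U) -> (I <= U)%VS).
Proof.
pose sp (s : seq 'M[F]_n) := <<[seq g - 1 | g <- s]>>%VS.
pose P k := `[< exists2 s, (forall g, g \in s -> S g) & \dim (sp s) = k >].
have P0 : exists k, P k by exists (\dim (sp [::])); apply/asboolP; exists [::].
have Pb k : P k -> (k <= \dim {:'M[F]_n})%N.
  by move=> /asboolP[s _ <-]; rewrite dimvS ?subvf.
case: (ex_maxnP P0 Pb) => k /asboolP[s sS sk] kmax.
exists (sp s) => [g Sg|U SU]; last first.
  by apply/span_subvP => _ /mapP[g gs ->]; apply: SU; exact: sS.
have : P (\dim (sp (g :: s))).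
  by apply/asboolP; exists (g :: s) => // h; rewrite inE => /predU1P[->|/sS].
move=> /kmax; rewrite -sk => dle.
have sub : (sp s <= sp (g :: s))%VS by rewrite /sp /= span_cons addvSr.
have /eqP -> : sp s == sp (g :: s) by rewrite eqEdim sub.
by rewrite /sp memv_span //= mem_head.
Qed.

(** The identity [(g - 1)(h - 1) = (gh - 1) - (g - 1) - (h - 1)] makes the span [I] of the [g - 1]
    stable under products. The trace vanishes on the generators, hence on [I], so [I] consists of
    nilpotent matrices. *)
Lemma prod_unipotent_monoid (l : seq 'M[F]_n) :
    (forall g h, S g -> S h -> S (g *m h)) ->
    (forall g, S g -> exists k, (g - 1) ^+ k = 0) ->
    (forall a, a \in l -> exists2 g, S g & a = g - 1) ->
  (n < size l)%N -> \prod_(a <- l) a = 0.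
Proof.
move=> SM Suni lS.
have [I SI Imin] := augmentation_vspace.
have IM a b : a \in I -> b \in I -> a *m b \in I.
  move=> aI bI.
  suff /subvP/(_ _ aI) : (I <= linfun (mulmxr b) @^-1: I)%VS.
    by rewrite -memv_preim lfunE.
  apply: (Imin) => g Sg; rewrite -memv_preim lfunE /=.
  suff /subvP/(_ _ bI) : (I <= linfun (mulmx (g - 1)) @^-1: I)%VS.
    by rewrite -memv_preim lfunE.
  apply: (Imin) => h Sh; rewrite -memv_preim lfunE /=.
  have -> : (g - 1) *m (h - 1) = (g *m h - 1) - (g - 1) - (h - 1).
    rewrite mulmxBl mulmxBr !mulmx1 mul1mx.
    by rewrite !opprB -!addrA; congr (_ + _);
      rewrite !addrA addNr add0r addrC addrA.
  by apply: memvB; [apply: memvB|]; apply: SI => //; exact: SM.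
have trI a : a \in I -> \tr a = 0.
  suff /subvP/[apply] : (I <= lker (linfun (mxtrace : 'M[F]_n -> F^o)))%VS.
    by rewrite memv_ker lfunE => /eqP.
  apply: (Imin) => g /Suni[k gk]; rewrite memv_ker lfunE /=.
  by rewrite (mxtrace_nilpotent gk).
apply: (@prod_nil_algebra _ _ I) => //.
- by move=> a; exact: mxtrace0_nilpotent.
- by apply/allP => a /lS[g Sg ->]; exact: SI.
Qed.

End UnipotentMonoid.

(** * Continuous seminorms *)

Section Seminorms.
Context (R : realType) (E : tvsType R[i]).

Lemma normc_real (a : R) : normc a%:C = `|a|.
Proof. by rewrite /normc /= expr0n /= addr0 sqrtr_sqr. Qed.

Lemma normc_ge0 (c : R[i]) : 0 <= normc c.
Proof. by case: c => a b; exact: sqrtr_ge0. Qed.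

Lemma normcN (c : R[i]) : normc (- c) = normc c.
Proof. by case: c => a b; rewrite /normc /= !sqrrN. Qed.

Lemma normc_lt (z e : R[i]) : 0 < e -> (`|z| < e) = (normc z < complex.Re e).
Proof. by case: z e => [a b] [c d]; rewrite !ltcE /= => /andP[/eqP-> _];
  rewrite eqxx. Qed.

Lemma nbhs_scale0 (v : E) (U : set E) : nbhs 0 U ->
  exists2 d : R, 0 < d & exists2 V, nbhs v V &
    forall c w, normc c < d -> V w -> U (c *: w).
Proof.
move=> U0.
have := @scale_continuous _ E (0, v) U; rewrite /= scale0r => /(_ U0).
move=> [[A V] /= [/nbhs_ballP[e /= e0 eA] Vv] AVU].
exists (complex.Re e); first by move: e0; rewrite ltcE => /andP[].
exists V => // c w ce Vw; apply: (AVU (c, w)); split => //=; apply: eA.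
by rewrite /ball /= sub0r normrN normc_lt.
Qed.

Lemma scale_tvs_continuous (c : R[i]) : continuous (fun w : E => c *: w).
Proof.
move=> v; apply: (@continuous_comp _ (R[i]^o * E)%type _ (fun w : E => (c, w))
  (fun x => x.1 *: x.2)); last exact: scale_continuous.
by apply: (@cvg_pair _ _ _ _ (nbhs (c : R[i]^o)));
  [exact: cvg_cst|exact: cvg_id].
Qed.

Lemma subr_tvs_continuous (v : E) : continuous (fun w : E => w - v).
Proof.
move=> u; apply: (@continuous_comp _ _ _ (fun w : E => (w, v))
  (fun x : E * E => x.1 - x.2)); last exact: sub_continuous.
by apply: cvg_pair; [exact: cvg_id|exact: cvg_cst].
Qed.

Lemma seminorm0 (p : E -> R) : continuous_seminorm p -> p 0 = 0.
Proof. by move=> [_ _ _ pZ];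
  rewrite -(scale0r 0) pZ ComplexField.Normc.normc0 mul0r. Qed.

Lemma seminormN (p : E -> R) v : continuous_seminorm p -> p (- v) = p v.
Proof. by move=> [_ _ _ pZ];
  rewrite -scaleN1r pZ normcN ComplexField.Normc.normc1 mul1r. Qed.

Lemma seminormB (p : E -> R) u v : continuous_seminorm p ->
  p (u - v) = p (v - u).
Proof. by move=> p_sn; rewrite -opprB seminormN. Qed.

Lemma seminorm_triB (p : E -> R) w u v : continuous_seminorm p ->
  p (u - v) <= p (u - w) + p (w - v).
Proof. by move=> [_ _ pD _]; have := pD (u - w) (w - v);
  rewrite addrA subrK. Qed.

Lemma seminorm_real (p : E -> R) (a : R) v : continuous_seminorm p ->
  p (a%:C *: v) = `|a| * p v.
Proof. by move=> [_ _ _ pZ]; rewrite pZ normc_real. Qed.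

Lemma seminorm_sum (p : E -> R) (I : Type) (r : seq I) (F : I -> E) :
  continuous_seminorm p -> p (\sum_(i <- r) F i) <= \sum_(i <- r) p (F i).
Proof.
move=> sp; have [_ _ pD _] := sp.
elim: r => [|i r IH]; first by rewrite !big_nil seminorm0.
by rewrite !big_cons (le_trans (pD _ _)) // lerD2l.
Qed.

Lemma nbhs_seminorm (p : E -> R) (v : E) (e : R) : continuous_seminorm p ->
  0 < e ->
  \forall w \near v, p (w - v) < e.
Proof.
move=> sp e0; have [pc _ _ _] := sp.
have c : continuous_at v (fun w => p (w - v)).
  apply: (@continuous_comp _ _ _ (fun w => w - v) p); last exact: pc.
  exact: subr_tvs_continuous.
move/cvgrPdist_lt/(_ e e0) : c; apply: filterS => w;
  rewrite subrr (seminorm0 sp).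
by rewrite sub0r normrN; apply: le_lt_trans; exact: ler_norm.
Qed.

(** * The Minkowski functional of a convex balanced neighbourhood of 0 *)

Section Gauge.
Variable A : set E.
Hypothesis A_nbhs : nbhs 0 A.
Hypothesis A_balanced : forall c v, normc c <= 1 -> A v -> A (c *: v).
Hypothesis A_convex : forall (t : R) u v, 0 < t < 1 -> A u -> A v ->
  A (t%:C *: u + (1 - t)%:C *: v).

Let dil v : set R := [set t | 0 < t /\ A (t^-1%:C *: v)].

Let gauge v : R := inf (dil v).

Let dil_has_inf v : has_inf (dil v).
Proof.
split; last by exists 0 => t [/ltW].
have [d d0 [V Vv VA]] := nbhs_scale0 v A_nbhs.
exists (2 / d); split; first by rewrite divr_gt0.
apply: VA; last exact: nbhs_singleton.
by rewrite normc_real invf_div ger0_norm ?divr_ge0 ?ltW // ltr_pdivrMr //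
  ltr_pMr // ltr1n.
Qed.

Let gauge_ge0 v : 0 <= gauge v.
Proof. by apply: lb_le_inf; [exact: (dil_has_inf v).1|move=> t [/ltW]]. Qed.

Let gauge_le v t : 0 < t -> A (t^-1%:C *: v) -> gauge v <= t.
Proof. by move=> t0 At; apply: ge_inf; [exact: (dil_has_inf v).2|]. Qed.

Let gauge_lt v t : gauge v < t -> A (t^-1%:C *: v).
Proof.
move=> vt; have [s [s0 As] st] : exists2 s, dil v s & s < t.
  by apply: inf_lt => //; exact: (dil_has_inf v).1.
have t0 : 0 < t := lt_trans s0 st.
have -> : t^-1%:C *: v = (s / t)%:C *: (s^-1%:C *: v).
  by rewrite scalerA -rmorphM /= mulrAC divff ?gt_eqF // mul1r.
apply: A_balanced => //; rewrite normc_real ger0_norm ?divr_ge0 ?ltW //.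
by rewrite ltr_pdivrMr // mul1r.
Qed.

Let gaugeZ_le c v : gauge (c *: v) <= normc c * gauge v.
Proof.
have [->|c0] := eqVneq c 0.
  rewrite scale0r ComplexField.Normc.normc0 mul0r; apply/ler_addgt0Pl => e e0.
  rewrite addr0; apply: gauge_le => //; rewrite scaler0; exact: nbhs_singleton.
have nc0 : 0 < normc c.
  rewrite lt_neqAle eq_sym normc_ge0 andbT.
  by apply: contra c0 => /eqP/ComplexField.Normc.eq0_normc ->.
rewrite -ler_pdivrMl //; apply/ler_addgt0Pl => e e0; rewrite ler_pdivrMl //.
have et0 : 0 < e + gauge v by rewrite ltr_pwDl.
apply: gauge_le; first by rewrite mulr_gt0.
have -> : (normc c * (e + gauge v))^-1%:C *: (c *: v) =
    ((normc c)^-1%:C * c) *: ((e + gauge v)^-1%:C *: v).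
  by rewrite !scalerA invfM rmorphM /=; congr (_ *: _); ring.
apply: A_balanced; last by apply: gauge_lt; rewrite ltrDr.
rewrite ComplexField.Normc.normcM normc_real ger0_norm ?invr_ge0 ?normc_ge0 //.
by rewrite mulVf // gt_eqF.
Qed.

Let gaugeZ c v : gauge (c *: v) = normc c * gauge v.
Proof.
apply/eqP; rewrite eq_le gaugeZ_le /=.
have [->|c0] := eqVneq c 0.
  by rewrite ComplexField.Normc.normc0 mul0r gauge_ge0.
have nc0 : normc c != 0 by apply: contra c0 =>
  /eqP/ComplexField.Normc.eq0_normc ->.
have := gaugeZ_le c^-1 (c *: v); rewrite scalerA mulVf // scale1r.
rewrite ComplexField.Normc.normcV ler_pdivlMl //.
by rewrite lt_neqAle eq_sym nc0 normc_ge0.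
Qed.

Let gaugeD u v : gauge (u + v) <= gauge u + gauge v.
Proof.
apply/ler_addgt0Pl => e e0.
pose s := gauge u + e / 2; pose t := gauge v + e / 2.
have e20 : 0 < e / 2 by rewrite divr_gt0.
have s0 : 0 < s by rewrite ltr_wpDl.
have t0 : 0 < t by rewrite ltr_wpDl.
have -> : e + (gauge u + gauge v) = s + t by rewrite /s /t; field.
have st0 : 0 < s + t by rewrite addr_gt0.
apply: gauge_le => //.
(* A convex combination of [u / s] and [v / t], both of which lie in [A]. *)
have -> : (s + t)^-1%:C *: (u + v) =
    (s / (s + t))%:C *: (s^-1%:C *: u) + (1 - s / (s + t))%:C *: (t^-1%:C *: v).
  have -> : 1 - s / (s + t) = t / (s + t) by field; rewrite gt_eqF.
  rewrite scalerDr !scalerA -!rmorphM /=.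
  by congr (_%:C *: _ + _%:C *: _); field; rewrite !gt_eqF.
apply: A_convex.
- by rewrite divr_gt0 //= ltr_pdivrMr // mul1r ltrDl.
- by apply: gauge_lt; rewrite ltrDl.
- by apply: gauge_lt; rewrite ltrDl.
Qed.

Lemma gauge_seminorm : exists2 p : E -> R, continuous_seminorm p &
  [set v | p v < 1] `<=` A.
Proof.
exists gauge; last first.
  by move=> v /= /gauge_lt; rewrite invr1 scale1r.
split => //; move=> v; apply/cvgrPdist_le => e e0.
have small : \forall w \near v, gauge (w - v) <= e.
  have sub : continuous_at v (fun w : E => e^-1%:C *: (w - v)).
    apply: (@continuous_comp _ _ _ (fun w : E => w - v) (fun w =>
      e^-1%:C *: w)).
      exact: subr_tvs_continuous.
    exact: scale_tvs_continuous.
  have /sub : nbhs (e^-1%:C *: (v - v)) A by rewrite subrr scaler0.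
  by apply: (@filterS _ (nbhs v)) => w; exact: gauge_le.
apply: filterS small => w wv.
have vw : gauge (v - w) <= e by rewrite -opprB -scaleN1r gaugeZ normcN
  ComplexField.Normc.normc1 mul1r.
have := gaugeD (w - v) v; have := gaugeD (v - w) w; rewrite !subrK => h1 h2.
by rewrite ler_norml; apply/andP; split; lra.
Qed.

End Gauge.

Lemma nbhs0_seminorm (U : set E) : nbhs 0 U ->
  exists2 p : E -> R, continuous_seminorm p & [set v | p v < 1] `<=` U.
Proof.
move=> U0; have [Bs Bconv [Bopen Bb]] := @locally_convex _ E.
have [b [Bb1 b0] bU] := Bb 0 U U0.
have nb : nbhs 0 b by apply: open_nbhs_nbhs; split => //; exact: Bopen.
(* Local convexity gives a convex [b] that need not be balanced; its balanced core [A] is convex as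
   well, and is a neighbourhood of 0 by joint continuity of the scaling. *)
pose A : set E := [set v | forall c, normc c <= 1 -> b (c *: v)].
have bc (t : R) u v : 0 < t < 1 -> b u -> b v ->
  b (t%:C *: u + (1 - t)%:C *: v).
  move=> /andP[t0 t1] bu bv.
  have T0 : 0 <= t%:C by rewrite ler0c ltW.
  have T1 : t%:C <= 1 by rewrite lecR ltW.
  have -> : (1 - t)%:C = 1 - t%:C by rewrite rmorphB.
  exact: set_mem (Bconv b (mem_set Bb1) u v (Itv01 T0 T1) (mem_set bu) (mem_set
    bv)).
have [p sp pA] : exists2 p : E ->
  R, continuous_seminorm p & [set v | p v < 1] `<=` A.
  apply: gauge_seminorm.
  - have [d d0 [V V0 VA]] := nbhs_scale0 0 nb.
    have /(@scale_tvs_continuous) : nbhs ((d / 2)^-1%:C *: (0 : E)) V.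
      by rewrite scaler0.
    apply: (@filterS _ (nbhs (0 : E))) => v Vv c c1.
    (* The modulus of the first scalar is at most [d / 2], uniformly for [c] in the unit disc. *)
    have -> : c *: v = (c * (d / 2)%:C) *: ((d / 2)^-1%:C *: v).
      by rewrite scalerA -mulrA -rmorphM /= divff ?mulr1 // gt_eqF // divr_gt0.
    apply: VA => //; rewrite ComplexField.Normc.normcM normc_real gtr0_norm
      ?divr_gt0 //.
    by have := normc_ge0 c; nra.
  - move=> c v c1 Av c' c'1; rewrite scalerA; apply: Av.
    rewrite ComplexField.Normc.normcM mulr_ile1 //; exact: normc_ge0.
  - move=> t u v t01 Au Av c c1;
    rewrite scalerDr !scalerA mulrC [c * _]mulrC -!scalerA.
    by apply: bc => //; [exact: Au|exact: Av].
exists p => // v /pA /(_ 1); rewrite scale1r => Av; apply: bU; apply: Av.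
by rewrite ComplexField.Normc.normc1.
Qed.

End Seminorms.

(** * Mean value inequalities and total differentials *)

(** Let [m] be the supremum of the points where the bound from [a] holds. The local estimate at [m]
    transfers the bound from points on the left to [m], and then to points on the right, so
    [m = b]. *)
Lemma local_lipschitz (R : realType) (g : R -> R) (a b c : R) : a <= b ->
    (forall s, a <= s <= b ->
      \forall u \near s, `|g u - g s| <= c * `|u - s|) ->
  `|g b - g a| <= c * (b - a).
Proof.
move=> ab gc.
pose S : set R := [set s | a <= s <= b /\ `|g s - g a| <= c * (s - a)].
have Sa : S a by split; [rewrite lexx|rewrite !subrr normr0 mulr0].
have Sb : has_sup S by split; [exists a|exists b => s [/andP[]]].
pose m := sup S.
have am : a <= m by exact: (ub_le_sup Sb.2).
have mb : m <= b by apply: ge_sup; [exists a|move=> s [/andP[]]].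
have mab : a <= m <= b by rewrite am mb.
have /nbhs_ballP[d /= d0 near_m] := gc m mab.
have bm u : `|m - u| < d -> `|g u - g m| <= c * `|u - m|.
  by move=> ?; apply: near_m.
have Sm : `|g m - g a| <= c * (m - a).
  have [s [/andP[sa sb] gs] sm] := sup_adherent d0 Sb.
  have sm' : s <= m by apply: (ub_le_sup Sb.2); split => //; rewrite sa.
  have := bm s; rewrite ger0_norm ?subr_ge0 // => /(_ ltac:(rewrite -/m in sm;
    lra)).
  rewrite distrC [X in c * X]distrC (ger0_norm (x := m - s)) ?subr_ge0 // => gm.
  have := ler_normD (g m - g s) (g s - g a); rewrite addrA subrK => /le_trans;
    apply.
  by apply: le_trans (lerD gm gs) _; rewrite -mulrDr addrA subrK.
have [<- //|mneb] := eqVneq m b.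
have mltb : m < b by rewrite lt_neqAle mneb.
pose u := Num.min (m + d / 2) b.
have mu : m < u by rewrite lt_min mltb andbT ltrDl divr_gt0.
have ub : u <= b by rewrite ge_min lexx orbT.
have ud : u <= m + d / 2 by rewrite ge_min lexx.
have Su : S u.
  split; first by rewrite ub andbT; lra.
  have := bm u; rewrite distrC ger0_norm ?subr_ge0 ?(ltW mu) // =>
    /(_ ltac:(lra)) gu.
  have := ler_normD (g u - g m) (g m - g a); rewrite addrA subrK => /le_trans;
    apply.
  by apply: le_trans (lerD gu Sm) _; rewrite -mulrDr addrA subrK.
by have := ub_le_sup Sb.2 Su; rewrite leNgt mu.
Qed.

Section Curves.
Context (R : realType) (E : tvsType R[i]).
Implicit Types (p : E -> R) (phi : R -> E).

Lemma cvg_seminorm (T : Type) (F : set_system T) (f : T ->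
  E) (l : E) : Filter F ->
    (forall p e, continuous_seminorm p -> 0 < e ->
      \forall t \near F, p (f t - l) < e) ->
  f @ F --> l.
Proof.
move=> FF fl U lU.
have : nbhs 0 (fun w => U (w + l)).
  have addl : continuous_at (0 : E) (fun w : E => w + l).
    apply: (@continuous_comp _ _ _ (fun w : E => (w, l)) (fun x : E * E =>
      x.1 + x.2)).
      by apply: cvg_pair; [exact: cvg_id|exact: cvg_cst].
    exact: add_continuous.
  by apply: addl; rewrite add0r.
move=> /nbhs0_seminorm[p sp pU].
have := fl p 1 sp ltr01; apply: filterS => t /pU.
by rewrite /= subrK.
Qed.

Lemma cvg_seminorm_lt (T : Type) (F : set_system T) (f : T -> E) (l : E) p e :
  Filter F -> f @ F --> l -> continuous_seminorm p -> 0 < e ->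
  \forall t \near F, p (f t - l) < e.
Proof. by move=> FF fl sp e0; exact: fl (nbhs_seminorm l sp e0). Qed.

(** The scalar function [p (phi s - phi a - (s - a) c)] satisfies the local estimate of
    [local_lipschitz]; the two orders of [a] and [b] are exchanged by [p (- v) = p v]. *)
Lemma seminorm_mean_value p phi (a b e : R) (c : E) : continuous_seminorm p ->
    (forall s, Num.min a b <= s <= Num.max a b ->
      \forall u \near s, p (phi u - phi s - (u - s)%:C *: c) <= e * `|u - s|) ->
  p (phi b - phi a - (b - a)%:C *: c) <= e * `|b - a|.
Proof.
move=> sp; have [_ p0 pD _] := sp.
wlog ab : a b / a <= b => [wl|hyp].
  have /orP[ab|ba] := le_total a b => hyp; first exact: wl.
  have := wl b a ba; rewrite minC maxC => /(_ hyp).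
  rewrite distrC -(seminormN _ sp); congr (p _ <= _).
  by rewrite -[a - b]opprB rmorphN /= scaleNr opprK opprD opprB.
rewrite (min_idPl ab) (max_idPr ab) in hyp.
pose g s := p (phi s - phi a - (s - a)%:C *: c).
have ga : g a = 0 by rewrite /g !subrr scale0r subr0 seminorm0.
have := @local_lipschitz R g a b e ab.
rewrite ga subr0 (ger0_norm (p0 _)) (ger0_norm (x := b - a)) ?subr_ge0 //;
  apply => s /hyp.
apply: filterS => u; apply: le_trans.
have -> : phi u - phi s - (u - s)%:C *: c =
    (phi u - phi a - (u - a)%:C *: c) - (phi s - phi a - (s - a)%:C *: c).
  have -> : (u - s)%:C = (u - a)%:C - (s - a)%:C.
    by rewrite -rmorphB /=; congr (_%:C); ring.
  rewrite scalerBl [in RHS]opprD [in RHS]addrACA -[in RHS]opprD; congr (_ - _).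
  by rewrite opprB addrA subrK.
rewrite /g; set x := (X in p X - _); set y := (X in _ - p X).
have := pD (x - y) y; have := pD (y - x) x;
  rewrite !subrK (seminormB y x sp) => h1 h2.
by rewrite ler_norml; apply/andP; split; lra.
Qed.

(** Supplies the local hypothesis of the mean value inequality: the slope error splits into the
    error of the difference quotient and [d - c]. *)
Lemma derivative_seminorm p phi (s e : R) (c d : E) : continuous_seminorm p ->
    (t^-1)%:C *: (phi (s + t) - phi s) @[t --> (0 : R)^'] --> d ->
      p (d - c) < e ->
  \forall u \near s, p (phi u - phi s - (u - s)%:C *: c) <= e * `|u - s|.
Proof.
move=> sp dphi pdc; have [_ p0 pD _] := sp.
have e0 : 0 < e - p (d - c) by rewrite subr_gt0.
have near0 : \forall t \near (0 : R), t != 0 ->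
    p (t^-1%:C *: (phi (s + t) - phi s) - d) < e - p (d - c).
  exact: cvg_seminorm_lt _ dphi sp e0.
have /nbhs_ballP[r /= r0 rP] := near0.
apply/nbhs_ballP; exists r => //= u su.
have [->|us] := eqVneq u s;
  first by rewrite !subrr scale0r subr0 normr0 mulr0 seminorm0.
have us0 : u - s != 0 by rewrite subr_eq0.
have := rP (u - s); rewrite /ball /= sub0r normrN distrC => /(_ su us0).
rewrite [s + _]addrC subrK => H.
have -> : phi u - phi s - (u - s)%:C *: c =
    (u - s)%:C *: (((u - s)^-1%:C *: (phi u - phi s) - d) + (d - c)).
  by rewrite addrA subrK scalerBr scalerA -rmorphM /= divff // scale1r.
rewrite (seminorm_real _ _ sp) [e * _]mulrC [`|s - u|]distrC;
  apply: ler_wpM2l => //.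
by apply: le_trans (pD _ _) _; rewrite -lerBrDr ltW.
Qed.

End Curves.

Section TotalDifferential.
Context (R : realType) (E : tvsType R[i]) (n : nat).
Implicit Types (W : set 'M[R]_n) (F : 'M[R]_n -> E).

Let unit_mx (k : 'I_n * 'I_n) : 'M[R]_n := delta_mx k.1 k.2.

(** Continuous partial derivatives give a total differential: the coordinates are moved one at a
    time, each move being controlled by the mean value inequality. The bound on the sum of the
    [|h k|] keeps all intermediate points near [x]. *)
Lemma total_differential W F (dF : 'M[R]_n -> 'M[R]_n -> E) (x : 'M[R]_n)
    (p : E -> R) (e : R) : open W -> W x -> continuous_seminorm p -> 0 < e ->
    (forall h y, W y ->
      (t^-1)%:C *: (F (y + t *: h) - F y) @[t --> (0 : R)^'] --> dF h y) ->
    (forall h, {for x, continuous (dF h)}) ->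
  exists2 r : R, 0 < r & forall (s : seq ('I_n * 'I_n)) (h : 'I_n * 'I_n -> R),
    \sum_(k <- s) `|h k| < r ->
    p (F (x + \sum_(k <- s) h k *: unit_mx k) - F x
       - \sum_(k <- s) (h k)%:C *: dF (unit_mx k) x)
    <= e * \sum_(k <- s) `|h k|.
Proof.
move=> Wo Wx sp e0 FdF dFc; have [_ p0 pD _] := sp.
have near_x : \forall y \near x, W y /\ forall k,
  p (dF (unit_mx k) y - dF (unit_mx k) x) < e.
  apply: filterI; first exact: open_nbhs_nbhs.
  apply: (@filter_forall _ _ _ (nbhs x)) => k.
  exact: cvg_seminorm_lt _ (dFc (unit_mx k)) sp e0.
have [B xB BP] := near_x.
(* A neighbourhood of a matrix contains a product of neighbourhoods of its entries; [r] is the least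
   of the finitely many radii, capped at 1. *)
have [r r0 rB] : exists2 r : R, 0 < r & forall k : 'I_n * 'I_n,
  ball (x k.1 k.2) r `<=` B k.1 k.2.
  have rk (k : 'I_n * 'I_n) : exists2 r : R,
    0 < r & ball (x k.1 k.2) r `<=` B k.1 k.2.
    by have /nbhs_ballP := xB k.1 k.2.
  pose r k := sval (cid2 (rk k)).
  exists (\big[Num.min/1]_k r k).
    elim/big_ind: _ => // [a b a0 b0|k _]; first by rewrite lt_min a0.
    by rewrite /r; case: cid2.
  move=> k y xy; have kB : ball (x k.1 k.2) (r k) `<=` B k.1 k.2 by rewrite /r;
    case: cid2.
  apply: kB; apply: le_ball xy; exact: bigmin_le.
exists r => // s h; elim: s => [|k s IH];
  first by rewrite !big_nil addr0 !subrr seminorm0 // mulr0.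
rewrite !big_cons => sr.
have sr' : \sum_(k <- s) `|h k| < r by apply: le_lt_trans sr; rewrite lerDr.
pose y := x + \sum_(k <- s) h k *: unit_mx k.
have := @seminorm_mean_value R E p (fun t => F (y + t *: unit_mx k)) 0 (h k) e
  (dF (unit_mx k) x) sp.
rewrite !subr0 scale0r addr0 => mv.
have {mv}mv : p (F (y + h k *: unit_mx k) - F y - (h k)%:C *: dF (unit_mx k) x)
  <= e * `|h k|.
  apply: mv => t tk; have th : `|t| <= `|h k|.
    move: tk; have [hk|/ltW hk] := leP 0 (h k).
      by move=> /andP[t0 tk]; rewrite !ger0_norm.
    by move=> /andP[tk t0]; rewrite !ler0_norm // lerN2.
  have [Wy pd] : W (y + t *: unit_mx k) /\ forall k',
    p (dF (unit_mx k') (y + t *: unit_mx k) - dF (unit_mx k') x) < e.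
    apply: BP => i j; apply: (rB (i, j)); rewrite /ball /=.
    have entry : `|(\sum_(k <- s) h k *: unit_mx k + t *: unit_mx k) i j| < r.
      apply: le_lt_trans sr; rewrite mxE addrC summxE.
      have bnd k' (z : R) : `|(z *: unit_mx k') i j| <= `|z|.
        by rewrite !mxE normrM; case: (_ && _);
          rewrite ?normr1 ?normr0 ?mulr1 ?mulr0.
      apply: le_trans (ler_normD _ _) (lerD (le_trans (bnd _ _) th) _).
      by apply: le_trans (ler_norm_sum _ _ _) (ler_sum _ _).
    by move: entry; rewrite -addrA [in X in _ ->
      X]mxE opprD addrA subrr sub0r normrN.
  apply: derivative_seminorm (pd k) => //.
  have := FdF (unit_mx k) _ Wy; apply: cvg_trans; apply: near_eq_cvg.
  by apply: nearW => u; rewrite -addrA -scalerDl.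
have := pD (F (y + h k *: unit_mx k) - F y - (h k)%:C *: dF (unit_mx k) x) (F y
  - F x - \sum_(k <- s) (h k)%:C *: dF (unit_mx k) x).
rewrite mulrDr => /le_trans/(_ (lerD mv (IH sr'))).
congr (p _ <= _).
rewrite /y addrACA -opprD; congr (_ - _).
by rewrite addrA subrK -addrA [in LHS](addrC (\sum_(k <- s) _)).
Qed.

End TotalDifferential.

(** * Derivatives of orbits *)

Section OneParameterMatrices.
Context (R : realType).

Lemma continuous_primitive (f : R -> R) : continuous f ->
  exists Phi : R -> R, forall x : R, -2 < x < 2 -> is_derive x 1 Phi (f x).
Proof.
move=> fc.
(* The base point -3 lies to the left of -2, and the interval from -2 to 2 holds all sums [t + s]
   with [|t| < 1] and [0 <= s < 1], which are needed below. *)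
exists (fun x => \int[lebesgue_measure]_(t in `[(-3), x]) f t)%R =>
  x /andP[x2 x2'].
have [] := @continuous_FTC1_closed R f (-3) x 3.
- lra.
- apply: continuous_compact_integrable; first exact: segment_compact.
  by apply: continuous_subspaceT.
- lra.
- exact: fc.
by move=> dF; rewrite derive1E => Fx; exact: DeriveDef dF Fx.
Qed.

Lemma is_derive_dnbhs (f : R -> R) (x df : R) : is_derive x 1 f df ->
  t^-1 * (f (x + t) - f x) @[t --> (0 : R)^'] --> df.
Proof.
move=> [dx <-].
have : h^-1 *: ((f \o shift x) (h *: 1) - f x) @[h --> (0 : R)^'] --> 'D_1 f x
  by exact: dx.
apply: cvg_trans; apply: near_eq_cvg; apply: nearW => t /=.
by rewrite [_ *: 1]mulr1 [t + x]addrC.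
Qed.

Lemma cvg_det (T : Type) (F : set_system T) (FF : Filter F) n
    (A : T -> 'M[R]_n) (B : 'M[R]_n) :
  (forall i j, A t i j @[t --> F] --> B i j) ->
    \det (A t) @[t --> F] --> \det B.
Proof.
move=> AB; rewrite /determinant.
elim: (index_enum _) => [|s r IH]; first by under eq_fun do rewrite big_nil;
  rewrite big_nil; exact: cvg_cst.
under eq_fun do rewrite big_cons; rewrite big_cons; apply: cvgD => //.
apply: cvgM; first exact: cvg_cst.
elim: (index_enum _) => [|i l IHl]; first by under eq_fun do rewrite big_nil;
  rewrite big_nil; exact: cvg_cst.
by under eq_fun do rewrite big_cons; rewrite big_cons; apply: cvgM => //;
  exact: AB.
Qed.

Variables (n : nat) (M : R -> 'M[R]_n).
Hypothesis Mc : forall i j, continuous (fun t => M t i j).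
Hypothesis M0 : M 0 = 1%:M.
Hypothesis MD : forall s t, M (s + t) = M s *m M t.

(* For a primitive [Phi] of [M], [M t *m (Phi a - Phi 0) = Phi (t + a) - Phi t],
   and [Phi a - Phi 0] is invertible for small [a]. *)
Lemma one_param_mx_derivable : exists X : 'M[R]_n, forall i j,
  t^-1 * (M t i j - (1%:M : 'M[R]_n) i j) @[t --> (0 : R)^'] --> X i j.
Proof.
pose phi i j : R -> R := sval (cid (continuous_primitive (Mc (i := i) (j :=
  j)))).
have phiD i j (x : R) : -2 < x < 2 -> is_derive x 1 (phi i j) (M x i j).
  by rewrite /phi; case: cid => F /=; exact.
pose Phi (t : R) : 'M[R]_n := \matrix_(i, j) phi i j t.
have shift_Phi (t s : R) : -1 < t < 1 -> 0 <= s < 1 ->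
    M t *m (Phi s - Phi 0) = Phi (t + s) - Phi t.
  move=> /andP[t1 t1'] /andP[s0 s1]; apply/matrixP => i j.
  (* An entry of [Phi (u + t) - M t *m Phi u]; its derivative in [u] vanishes because
     [M (u + t) = M t *m M u]. *)
  pose g : R -> R := (phi i j \o shift t) - \sum_(k < n) (M t i k \*: phi k j).
  have gE u : g u = phi i j (u + t) - \sum_k M t i k * phi k j u.
    by rewrite /g /= fctE fct_sumE.
  have dg (u : R) : -1 < u < 1 -> is_derive u 1 g 0.
    move=> /andP[u1 u1'].
    have -> : 0 = M (u + t) i j * 1 - \sum_k M t i k *: M u k j.
      by rewrite mulr1 [u + t]addrC MD mxE subrr.
    apply: is_deriveB.
      apply: is_derive1_comp; last exact: is_derive_shift.
      by apply: phiD; rewrite /=; lra.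
    apply: is_derive_sum => k; apply: is_deriveZ; apply: phiD; lra.
  have gs : g s = g 0.
    have [] := @MVT_segment R g (fun=> 0) 0 s s0.
    - by move=> x; rewrite in_itv /= => /andP[x0 xs]; apply: dg; lra.
    - apply: derivable_within_continuous => x;
      rewrite in_itv /= => /andP[x0 xs].
      by have [] : is_derive x 1 g 0 by apply: dg; lra.
    by move=> c _ /eqP; rewrite mul0r subr_eq0 => /eqP.
  move: gs; rewrite !gE add0r => gs.
  rewrite !mxE [t + s]addrC.
  have -> : phi i j (s + t) = phi i j t - \sum_k M t i k * phi k j 0 + \sum_k M
    t i k * phi k j s by rewrite -gs subrK.
  rewrite (_ : forall x y z : R, x - y + z - x = z - y); last by move=> x y z;
    ring.
  rewrite -sumrB.
  by apply: eq_bigr => k _; rewrite !mxE mulrBr.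
(* [(Phi t - Phi 0) / t] tends to [M 0 = 1], so its determinant is nonzero for small [t]. *)
have [a a1 Qu] : exists2 a, 0 < a < 1 & Phi a - Phi 0 \in unitmx.
  have : \det (t^-1 *: (Phi t - Phi 0)) @[t --> (0 : R)^'] --> \det (1%:M :
    'M[R]_n).
    apply: cvg_det => i j; rewrite -M0.
    have := is_derive_dnbhs (phiD i j 0 ltac:(lra)).
    apply: cvg_trans; apply: near_eq_cvg; apply: nearW => t.
    by rewrite !mxE add0r.
  rewrite det1 => /cvgrPdist_lt/(_ 1 ltr01) near0.
  have {}near0 : \forall t \near (0 : R), t != 0 ->
    `|1 - \det (t^-1 *: (Phi t - Phi 0))| < 1 by exact: near0.
  have /nbhs_ballP[r /= r0 rP] := near0.
  pose a : R := Num.min (r / 2) (1 / 2).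
  have a0 : 0 < a by rewrite lt_min !divr_gt0.
  have ar : a <= r / 2 by rewrite ge_min lexx.
  have a2 : a <= 1 / 2 by rewrite ge_min lexx orbT.
  exists a; first by rewrite a0 /=; lra.
  have := rP a; rewrite /ball /= sub0r normrN gtr0_norm // gt_eqF // =>
    /(_ ltac:(lra) isT).
  rewrite unitmxE detZ unitfE; apply: contraPneq => ->.
  by rewrite mulr0 subr0 normr1 ltxx.
(* The derivative at 0 of [(Phi (t + a) - Phi t) *m invmx (Phi a - Phi 0)], which is [M t] for
   [|t| < 1]. *)
exists ((M a - 1%:M) *m invmx (Phi a - Phi 0)) => i j.
have ME t : -1 < t < 1 -> M t = (Phi (t + a) - Phi t) *m invmx (Phi a - Phi 0).
  move=> t1; rewrite -shift_Phi //; first by rewrite mulmxK.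
  by case/andP: a1 => a0 ->; rewrite ltW.
pose D (t : R) k := (phi i k (t + a) - phi i k t) - (phi i k a - phi i k 0).
have Dlim k : t^-1 * D t k @[t --> (0 : R)^'] --> (M a - 1%:M) i k.
  rewrite !mxE -[X in _ - X](_ : M 0 i k = _); last by rewrite M0 mxE.
  have lim1 := is_derive_dnbhs (phiD i k a ltac:(lra)).
  have lim2 := is_derive_dnbhs (phiD i k 0 ltac:(lra)).
  suff -> : (fun t => t^-1 * D t k) = (fun t =>
    t^-1 * (phi i k (a + t) - phi i k a)
      - t^-1 * (phi i k (0 + t) - phi i k 0)) by exact: cvgB.
  by apply/funext => t; rewrite /D add0r [t + a]addrC; ring.
have : \sum_k (t^-1 * D t k) * invmx (Phi a - Phi 0) k j @[t --> (0 : R)^'] -->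
    ((M a - 1%:M) *m invmx (Phi a - Phi 0)) i j.
  rewrite mxE; elim: (index_enum _) => [|k l IHl].
    by under eq_fun do rewrite big_nil; rewrite big_nil; exact: cvg_cst.
  under eq_fun do rewrite big_cons; rewrite big_cons; apply: cvgD => //.
  by apply: cvgM; [exact: Dlim|exact: cvg_cst].
have near1 : \forall t \near (0 : R)^', -1 < t < 1.
  apply: (@nbhs_dnbhs R 0); apply/nbhs_ballP; exists 1 => //= t.
  by rewrite /ball /= sub0r normrN ltr_norml.
apply: cvg_trans; apply: near_eq_cvg; apply: filterS near1 => t t1.
rewrite -M0 ME // (ME 0); last by lra.
rewrite !mxE -sumrB mulr_sumr; apply: eq_bigr => k _.
by rewrite !mxE add0r /D; ring.
Qed.

End OneParameterMatrices.

Lemma cvg_sum_seq (R : realType) (T : Type) (F : set_system T) (FF : Filter F)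
    (I : Type) (s : seq I) (f : I -> T -> R) (l : I -> R) :
  (forall i, f i t @[t --> F] --> l i) ->
  \sum_(i <- s) f i t @[t --> F] --> \sum_(i <- s) l i.
Proof.
move=> fl; elim: s => [|i s IH].
  by under eq_fun do rewrite big_nil; rewrite big_nil; exact: cvg_cst.
by under eq_fun do rewrite big_cons; rewrite big_cons; apply: cvgD.
Qed.

Lemma mx_entry_continuous (R : realType) n (i j : 'I_n) :
  continuous (fun A : 'M[R]_n => A i j).
Proof.
move=> A U AU; exists (fun i' j' => if (i' == i) && (j' == j) then U else setT).
  by move=> i' j'; case: ifP => [/andP[/eqP-> /eqP->]//|_]; exact: filterT.
by move=> B /(_ i j); rewrite !eqxx.
Qed.

(** * Linear spans, their closures, and curves with derivative in a span *)

Section Spans.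
Context (R : realType) (E : tvsType R[i]).
Implicit Types (A B : set E).

Lemma sub_lspan A : A `<=` lspan A.
Proof.
move=> v Av; exists 1%N, (fun=> 1), (fun=> v); split => //.
by rewrite big_ord_recl big_ord0 addr0 scale1r.
Qed.

Lemma lspanZ A (c : R[i]) v : lspan A v -> lspan A (c *: v).
Proof.
move=> [m [a [w [Aw ->]]]]; exists m, (fun i => c * a i), w; split => //.
by rewrite scaler_sumr; apply: eq_bigr => i _; rewrite scalerA.
Qed.

Lemma lspanD A u v : lspan A u -> lspan A v -> lspan A (u + v).
Proof.
move=> Au Av; rewrite -[v]opprK; apply: lspan_sub => //.
by rewrite -scaleN1r; exact: lspanZ.
Qed.

Lemma lspan_min A B : B 0 -> (forall u v, B u -> B v -> B (u + v)) ->
  (forall c v, B v -> B (c *: v)) -> A `<=` B -> lspan A `<=` B.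
Proof.
move=> B0 BD BZ AB _ [m [a [w [Aw ->]]]].
by elim/big_ind: _ => // i _; apply: BZ; exact/AB/Aw.
Qed.

Lemma closure_map A B (f : E -> E) : continuous f ->
  (forall a, A a -> closure B (f a)) -> forall a, closure A a ->
    closure B (f a).
Proof.
move=> fc fAB a Aa; apply: (closed_closure (A := B)) => U Uf.
have [b [Ab Ub]] := Aa _ (fc a _ Uf).
by exists (f b); split => //; exact: fAB.
Qed.

Lemma closureZ A (c : R[i]) v : closure (lspan A) v ->
  closure (lspan A) (c *: v).
Proof.
move: v; apply: (@closure_map _ _ (fun w => c *: w));
  first exact: scale_tvs_continuous.
by move=> a Aa; apply: subset_closure; exact: lspanZ.
Qed.

Lemma closureB A u v : closure (lspan A) u -> closure (lspan A) v ->
  closure (lspan A) (u - v).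
Proof. by apply: closure_sub; exact: lspan_sub. Qed.

Lemma closureD A u v : closure (lspan A) u -> closure (lspan A) v ->
  closure (lspan A) (u + v).
Proof. by move=> Au Av; rewrite -[v]opprK; apply: closureB => //;
  rewrite -scaleN1r; exact: closureZ. Qed.

Lemma closure_lspan_linear A B (f : E -> E) : continuous f ->
    (forall (c : R[i]) u v, f (c *: u + v) = c *: f u + f v) ->
    (forall a, A a -> closure (lspan B) (f a)) ->
  forall a, closure (lspan A) a -> closure (lspan B) (f a).
Proof.
move=> fc fL fAB; have f0 : f 0 = 0.
  by have := fL (-1) 0 0; rewrite scaler0 addr0 scaleN1r addNr.
have fD u v : f (u + v) = f u + f v by have := fL 1 u v; rewrite !scale1r.
have fZ c v : f (c *: v) = c *: f v by have := fL c v 0; rewrite f0 !addr0.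
apply: closure_map => //; apply: lspan_min => // [|u v|c v].
- by rewrite f0; apply: subset_closure; exact: lspan0.
- by rewrite fD; exact: closureD.
- by rewrite fZ; exact: closureZ.
Qed.

Lemma closure_seminorm A v :
  (forall p, continuous_seminorm p -> exists2 a, A a & p (v - a) < 1) ->
    closure A v.
Proof.
move=> Av U Uv.
have : nbhs 0 (fun w : E => U (v - w)).
  have subc : continuous_at (0 : E) (fun w : E => v - w).
    apply: (@continuous_comp _ _ _ (fun w : E => (v, w)) (fun x : E * E =>
      x.1 - x.2)).
      by apply: cvg_pair; [exact: cvg_cst|exact: cvg_id].
    exact: sub_continuous.
  by apply: subc; rewrite subr0.
move=> /nbhs0_seminorm[p sp pU].
have [a Aa /pU] := Av p sp; rewrite /= subKr => Ua.
by exists a.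
Qed.

Lemma closureP A v p e : continuous_seminorm p -> 0 < e -> closure A v ->
  exists2 a, A a & p (v - a) < e.
Proof.
move=> sp e0 /(_ _ (nbhs_seminorm v sp e0))[a [Aa pa]].
by exists a => //; rewrite seminormB.
Qed.

(* Local Lipschitz estimates are applied to the quotient seminorm
   [q x = inf_(a in A) p (x - a)], which does not see the derivative. *)
Lemma curve_closed_span A (phi : R -> E) (a b : R) : a <= b ->
    (forall s, exists2 d, lspan A d &
      (t^-1)%:C *: (phi (s + t) - phi s) @[t --> (0 : R)^'] --> d) ->
  closure (lspan A) (phi b - phi a).
Proof.
move=> ab dphi; apply: closure_seminorm => p sp; have [_ p0 pD _] := sp.
pose Q x := [set p (x - a) | a in lspan A].
pose q x := inf (Q x).
have Qinf x : has_inf (Q x).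
  split; first by exists (p (x - 0)), 0 => //; exact: lspan0.
  by exists 0 => _ [c _ <-].
have q0 x : 0 <= q x by apply: lb_le_inf; [exact: (Qinf x).1|move=> _ [c _ <-]].
(* [q] is subadditive with respect to [p] and invariant under translation by the span. *)
have qle x y d : lspan A d -> q x <= p (x - y - d) + q y.
  move=> Ad; rewrite -lerBlDl; apply: lb_le_inf; first exact: (Qinf y).1.
  move=> _ [c Ac <-]; rewrite lerBlDl; apply: (@le_trans _ _ (p (x - (d + c)))).
    by apply: ge_inf; [exact: (Qinf x).2|exists (d + c) => //; exact: lspanD].
  have -> : x - (d + c) = x - y - d + (y - c).
    by rewrite [x - y - d]addrAC [RHS]addrA subrK opprD addrA.
  exact: pD.
have : q (phi b - phi a) < 1.
  have [->|aneb] := eqVneq b a.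
    rewrite subrr; apply: le_lt_trans (_ : p (0 - 0) < 1);
      last by rewrite subrr seminorm0.
    by apply: ge_inf; [exact: (Qinf _).2|exists 0 => //; exact: lspan0].
  have ba0 : 0 < b - a by rewrite subr_gt0 lt_neqAle eq_sym aneb.
  (* With this slope the total increase of [g] is at most [e * (b - a) = 1/2], below the threshold
     1. *)
  pose e := (2 * (b - a))^-1; have e0 : 0 < e by rewrite invr_gt0 mulr_gt0.
  pose g s := q (phi s - phi a).
  have ga : g a = 0.
    apply/eqP; rewrite eq_le q0 andbT /g subrr;
      rewrite -[X in _ <= X](seminorm0 sp) -[X in p X](subr0 0).
    by apply: ge_inf; [exact: (Qinf _).2|exists 0 => //; exact: lspan0].
  have := @local_lipschitz R g a b e ab.
  rewrite ga subr0 (ger0_norm (q0 _)) => lip.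
  apply: (@le_lt_trans _ _ (e * (b - a))).
    apply: lip => s _; have [d Ad sd] := dphi s.
    have pdd : p (d - d) < e by rewrite subrr seminorm0.
    have := derivative_seminorm sp sd pdd; apply: filterS => u; apply: le_trans.
    have Aus : lspan A ((u - s)%:C *: d) by exact: lspanZ.
    have Asu : lspan A (- ((u - s)%:C *: d)) by rewrite -scaleN1r;
      exact: lspanZ.
    have := qle (phi u - phi a) (phi s - phi a) _ Aus.
    have := qle (phi s - phi a) (phi u - phi a) _ Asu.
    rewrite !opprB !addrA !subrK opprK => h1 h2.
    have h3 : p (phi s - phi u + (u - s)%:C *: d) = p (phi u - phi s - (u -
      s)%:C *: d).
      by rewrite -(seminormN _ sp) opprD opprB.
    by rewrite /g ler_norml; apply/andP; split; lra.
  by rewrite /e invfM -mulrA mulVf ?gt_eqF // mulr1 invf_lt1 // ltr1n.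
move=> /inf_lt[]; first exact: (Qinf _).1.
by move=> _ [c Ac <-] pc; exists c.
Qed.

End Spans.

(** * Differentiability of orbits along one-parameter subgroups *)

Section OrbitDerivative.
Context (R : realType) (n : nat) (G : topologicalGroupType) (rho : G ->
  'M[R]_n).
Context (E : tvsType R[i]) (act : G -> E -> E).
Hypothesis rhoc : continuous rho.
Hypothesis rho1 : rho 1%g = 1%:M.
Hypothesis rhoM : forall x y, rho (x * y)%g = rho x *m rho y.

Lemma lie_algebra0 (H : set G) (gamma : R -> G) : lie_algebra H gamma ->
  gamma 0 = 1%g.
Proof.
move=> [_ gD _]; apply: (mulgI (gamma 0)).
by rewrite -gD addr0 mulg1.
Qed.

(** Chain rule: near the identity the orbit map is [F] composed with [rho], where [F] has a total
    differential at the identity matrix, and [rho (gamma t)] is differentiable by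
    [one_param_mx_derivable]. *)
Lemma orbit_derivable (H : set G) (gamma : R -> G) (v : E) :
    lie_algebra H gamma -> smooth_map rho (fun g => act g v) ->
  (forall g h v, act (g * h)%g v = act g (act h v)) -> act 1%g v = v ->
  exists w, lie_act act gamma v w.
Proof.
move=> Hg sv actM act1; have g0 := lie_algebra0 Hg; have [gc gD _] := Hg.
have [X XP] : exists X : 'M[R]_n, forall i j,
    t^-1 * (rho (gamma t) i j - (1%:M : 'M[R]_n) i j) @[t --> (0 : R)^'] --> X
      i j.
  apply: one_param_mx_derivable.
  - move=> i j t; apply: (@continuous_comp _ _ _ (fun t =>
    rho (gamma t)) (fun A : 'M[R]_n => A i j)).
      by apply: continuous_comp; [exact: gc|exact: rhoc].
    exact: mx_entry_continuous.
  - by rewrite g0.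
  - by move=> s t; rewrite gD rhoM.
have [U [W [F [Uo U1 Wo Fs UF]]]] := sv 1%g.
have [_ [dF dFP]] := Fs 1%N.
have W1 : W 1%:M by rewrite -rho1; exact: (UF _ U1).1.
pose d (k : 'I_n * 'I_n) := dF (delta_mx k.1 k.2) 1%:M.
exists (\sum_k (X k.1 k.2)%:C *: d k).
apply: cvg_seminorm => p e sp e0; have [_ p0 pD _] := sp.
pose h t (k : 'I_n * 'I_n) := (rho (gamma t) k.1 k.2 - (1%:M : 'M[R]_n) k.1
  k.2).
pose SX := \sum_(k : 'I_n * 'I_n) `|X k.1 k.2|.
have SX0 : 0 <= SX by apply: sumr_ge0.
(* Ensures [e1 * SX < e], which is the limit of the error bound in [near2]; the added 1 covers
   [SX = 0]. *)
pose e1 := e / (SX + 1).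
have e10 : 0 < e1 by rewrite divr_gt0 // ltr_wpDl.
have [r r0 rP] := total_differential Wo W1 sp e10 (fun h =>
  (dFP h).1) (fun h => (dFP h).2.1 _ W1).
have hlim k : t^-1 * h t k @[t --> (0 : R)^'] --> X k.1 k.2 by exact: XP.
have h0 k : h t k @[t --> (0 : R)^'] --> (0 : R).
  move=> B B0; apply: (@nbhs_dnbhs R 0); move: B B0.
  have hc : continuous (fun t => h t k).
    move=> t; apply: cvgB; last exact: cvg_cst.
    apply: (@continuous_comp _ _ _ (fun t => rho (gamma t)) (fun A : 'M[R]_n =>
      A k.1 k.2)).
      by apply: continuous_comp; [exact: gc|exact: rhoc].
    exact: mx_entry_continuous.
  by have := hc 0; rewrite /continuous_at {2}/h g0 rho1 subrr.
have near1 : \forall t \near (0 : R)^', \sum_k `|h t k| < r.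
  have : \sum_k `|h t k| @[t --> (0 : R)^'] --> \sum_(k : 'I_n * 'I_n) (0 : R).
    by apply: cvg_sum_seq => k; rewrite -[X in _ --> X](normr0 R);
      apply: cvg_norm; exact: h0.
  by rewrite big1 // => /cvgr_lt; exact.
have near2 : \forall t \near (0 : R)^',
    e1 * (\sum_k `|t^-1 * h t k|)
      + \sum_k `|t^-1 * h t k - X k.1 k.2| * p (d k) < e.
  have : e1 * (\sum_k `|t^-1 * h t k|)
      + \sum_k `|t^-1 * h t k - X k.1 k.2| * p (d k) @[t --> (0 : R)^'] -->
      e1 * SX + \sum_(k : 'I_n * 'I_n) `|X k.1 k.2 - X k.1 k.2| * p (d k).
    apply: cvgD.
      apply: cvgM; first exact: cvg_cst.
      by apply: cvg_sum_seq => k; apply: cvg_norm; exact: hlim.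
    apply: cvg_sum_seq => k; apply: cvgM; last exact: cvg_cst.
    by apply: cvg_norm; apply: cvgB; [exact: hlim|exact: cvg_cst].
  move=> /cvgr_lt; apply; rewrite [X in _ + X]big1 ?addr0; last first.
    by move=> k _; rewrite subrr normr0 mul0r.
  by rewrite /e1 mulrAC ltr_pdivrMr ?ltr_wpDl // ltr_pM2l // ltrDl.
have near3 : \forall t \near (0 : R)^', U (gamma t).
  apply: (@nbhs_dnbhs R 0); apply: gc; rewrite g0; exact: open_nbhs_nbhs.
have near4 : \forall t \near (0 : R)^', t != 0 by exact: nbhs_dnbhs_neq.
near=> t.
have Ut : U (gamma t) by near: t.
have t0 : t != 0 by near: t.
have -> : act (gamma t) v - v = F (rho (gamma t)) - F 1%:M.
  by rewrite (UF _ Ut).2 -rho1 -(UF _ U1).2 act1.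
have -> : rho (gamma t) = 1%:M + \sum_(k : 'I_n * 'I_n) h t k *: delta_mx k.1
  k.2.
  rewrite -(pair_bigA _ (fun i j => h t (i, j) *: delta_mx i j)) /=.
  transitivity (1%:M + (rho (gamma t) - 1%:M)); first by rewrite addrC subrK.
  congr (_ + _); rewrite [LHS]matrix_sum_delta.
  by apply: eq_bigr => i _; apply: eq_bigr => j _; rewrite /h !mxE.
have sr : \sum_k `|h t k| < r by near: t.
(* The first summand is the remainder of [F], the second the error of the difference quotients of
   the matrix entries. *)
have split_diff (x : E) : (t^-1)%:C *: x - \sum_k (X k.1 k.2)%:C *: d k =
    (t^-1)%:C *: (x - \sum_k (h t k)%:C *: d k) + \sum_k (t^-1 * h t k - X k.1
      k.2)%:C *: d k.
  rewrite scalerBr -addrA; congr (_ + _);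
    rewrite scaler_sumr -!sumrN -big_split /=.
  apply: eq_bigr => k _.
  have -> : (t^-1 * h t k - X k.1 k.2)%:C = (t^-1)%:C * (h t k)%:C - (X k.1
    k.2)%:C.
    by rewrite -rmorphM -rmorphB.
  rewrite scalerBl scalerA.
  by rewrite addrA addNr add0r.
rewrite split_diff; apply: le_lt_trans (pD _ _) _.
have : e1 * (\sum_k `|t^-1 * h t k|)
    + \sum_k `|t^-1 * h t k - X k.1 k.2| * p (d k) < e by near: t.
apply: le_lt_trans; apply: lerD.
  rewrite (seminorm_real _ _ sp);
    under [X in _ <= _ * X]eq_bigr do rewrite normrM.
  rewrite -mulr_sumr mulrCA; apply: ler_wpM2l => //; exact: rP.
apply: le_trans (seminorm_sum _ _ sp) _.
by apply: ler_sum => k _; rewrite (seminorm_real _ _ sp).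
Unshelve. all: by end_near. Qed.

End OrbitDerivative.

(** * Action of the unipotent group on the filtration *)

Section LieFiltration.
Context (R : realType) (n : nat) (G : topologicalGroupType) (rho : G ->
  'M[R]_n).
Context (E : tvsType R[i]) (act : G -> E -> E) (N : set G).
Hypothesis rhoc : continuous rho.
Hypothesis rho1 : rho 1%g = 1%:M.
Hypothesis rhoM : forall x y, rho (x * y)%g = rho x *m rho y.
Hypothesis repE : continuous_representation act.
Hypothesis smE : forall v, smooth_map rho (fun g => act g v).
Hypothesis NG : is_subgroup N.

Let V k := closure (lie_power act (lie_algebra N) k).

Lemma act_continuous g : continuous (act g).
Proof.
have [_ _ _ ac] := repE; move=> v.
apply: (@continuous_comp _ _ _ (fun v => (g, v)) (fun gv : G * E =>
  act gv.1 gv.2)).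
  by apply: cvg_pair; [exact: cvg_cst|exact: cvg_id].
exact: ac.
Qed.

Lemma actD g u v : act g (u + v) = act g u + act g v.
Proof. by have [_ _ L _] := repE; have := L g 1 u v; rewrite !scale1r. Qed.

Lemma act0 g : act g 0 = 0.
Proof. by apply: (addrI (act g 0)); rewrite -actD !addr0. Qed.

Lemma actZ g c v : act g (c *: v) = c *: act g v.
Proof. by have [_ _ L _] := repE; have := L g c v 0; rewrite act0 !addr0. Qed.

Lemma actB g u v : act g (u - v) = act g u - act g v.
Proof. by rewrite actD -scaleN1r actZ scaleN1r. Qed.

Lemma lie_algebra_conj g (gamma : R -> G) : N g -> lie_algebra N gamma ->
  lie_algebra N (fun t => g * gamma t * g^-1)%g.
Proof.
move=> Ng [gc gD gN]; have [N1 NM NV] := NG; split.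
- move=> t; apply: (@continuous_comp _ _ _ (fun t =>
  (g * gamma t, g^-1)%g) (fun xy : G * G => (xy.1 * xy.2)%g));
  last exact: mulg_continuous.
  apply: cvg_pair; last exact: cvg_cst.
  apply: (@continuous_comp _ _ _ (fun t => (g, gamma t)) (fun xy : G * G =>
    (xy.1 * xy.2)%g)); last exact: mulg_continuous.
  by apply: cvg_pair; [exact: cvg_cst|exact: gc].
- by move=> s t; rewrite gD !mulgA mulgVK.
- by move=> t; apply: (NM); [exact: NM|exact: NV].
Qed.

(** Moving [g] through a word conjugates each of its letters, and the Lie algebra of [N] is stable
    under conjugation by [N]. *)
Lemma lie_words_act k g v : N g -> lie_words act (lie_algebra N) k v ->
  lie_words act (lie_algebra N) k (act g v).
Proof.
move=> Ng; have [a1 aM _ _] := repE;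
  elim: k v => //= k IH w [gamma [v [Ngam vk vw]]].
exists (fun t => g * gamma t * g^-1)%g, (act g v); split;
  first exact: lie_algebra_conj.
  exact: IH.
rewrite /lie_act.
have := cvg_comp _ _ vw (@act_continuous g w); apply: cvg_trans;
  apply: near_eq_cvg; apply: nearW => t /=.
by rewrite actZ actB -!aM mulgVK aM.
Qed.

(** The innermost letter of a word is absorbed into the vector on which the word acts. *)
Lemma lie_filtration_decr k : V k.+1 `<=` V k.
Proof.
apply: closure_subset => _ [m [a [w [ww ->]]]]; exists m, a, w; split => // i.
move: (ww i) => {ww}; elim: k (w i) => //= k IH v [gamma [u [Ng uk uv]]].
by exists gamma, u; split => //; exact: IH.
Qed.

(** By linearity and continuity [v] may be taken to be a word. The curve [gamma s . v] then has
    derivative [gamma s . (X v)], a word with one more letter by [lie_words_act], and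
    [curve_closed_span] applies. *)
Lemma lie_filtration_step k (gamma : R -> G) t v : lie_algebra N gamma ->
  V k v ->
  V k.+1 (act (gamma t) v - v).
Proof.
move=> Ng; have [a1 aM L _] := repE; have [gc gD gN] := Ng.
move: v; apply: (@closure_lspan_linear _ _ _ _ (fun v => act (gamma t) v - v)).
- move=> v; apply: (@continuous_comp _ _ _ (fun v =>
  (act (gamma t) v, v)) (fun x : E * E => x.1 - x.2)).
    by apply: cvg_pair; [exact: act_continuous|exact: cvg_id].
  exact: sub_continuous.
- by move=> c u v; rewrite L scalerBr addrACA opprD.
move=> v vk.
have [w vw] := orbit_derivable rhoc rho1 rhoM Ng (smE v) aM (a1 v).
have wk : lie_words act (lie_algebra N) k.+1 w by exists gamma, v.
have dphi s : exists2 d, lspan (lie_words act (lie_algebra N) k.+1) d &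
    (u^-1)%:C *: (act (gamma (s + u)) v - act (gamma s) v) @[u --> (0 : R)^']
      --> d.
  exists (act (gamma s) w); first by apply: sub_lspan; exact: lie_words_act.
  have := cvg_comp _ _ vw (@act_continuous (gamma s) w).
  apply: cvg_trans; apply: near_eq_cvg; apply: nearW => u /=.
  by rewrite actZ actB -aM gD.
have g0 := lie_algebra0 Ng.
have [t0|/ltW t0] := leP 0 t.
  by have := curve_closed_span t0 dphi; rewrite g0 a1.
have := curve_closed_span t0 dphi; rewrite g0 a1 => /(closureZ (c := -1)).
by rewrite scaleN1r opprB.
Qed.

End LieFiltration.

(** * Polynomial growth *)

Section Growth.

Lemma expr_unipotent (R : pzRingType) (y : R) L m : (y - 1) ^+ L = 0 ->
  y ^+ m = \sum_(i < L) (y - 1) ^+ i *+ 'C(m, i).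
Proof.
move=> yL; have aM i : (L <= i)%N -> (y - 1) ^+ i = 0.
  by move=> /subnK <-; rewrite exprD yL mulr0.
have extend q d : (forall i, (q <= i)%N -> (y - 1) ^+ i *+ 'C(m, i) = 0) ->
    \sum_(i < q + d) (y - 1) ^+ i *+ 'C(m,
      i) = \sum_(i < q) (y - 1) ^+ i *+ 'C(m, i).
  move=> f0; rewrite big_split_ord /= [X in _ + X]big1 ?addr0 // => i _.
  by apply: f0; rewrite leq_addr.
(* Both sums equal the one over [L + m.+1] indices: the extra terms vanish by nilpotency on one side
   and by vanishing binomial coefficients on the other. *)
rewrite -(extend L m.+1) => [|i /aM ->]; last by rewrite mul0rn.
rewrite addnC extend => [|i mi]; last by rewrite bin_small // mulr0n.
rewrite [in LHS](_ : y = 1 + (y - 1)); last by rewrite addrC subrK.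
rewrite exprDn_comm; last by rewrite /GRing.comm mul1r mulr1.
by apply: eq_bigr => i _; rewrite expr1n mul1r.
Qed.

Lemma leq_bin_expn m i : ('C(m, i) <= m.+1 ^ i)%N.
Proof.
elim: m i => [|m IH] [|i]; rewrite ?bin0 ?expn0 //.
rewrite binS (leq_trans (leq_add (IH _) (IH _))) // expnS -mulSnr expnS.
by apply: leq_mul => //; case: i => // i; rewrite leq_exp2r.
Qed.

Variables (R : realType) (n : nat) (S : set 'M[R]_n).
Hypothesis SM : forall g h, S g -> S h -> S (g *m h).
Hypothesis Suni : forall g, S g -> exists k, (g - 1) ^+ k = 0.

(** Each [y ^+ m] is expanded in powers of [y - 1], which are collected in [bs]. Every factor
    [y - 1] costs one power of [m + 1], and by Kolchin no nonzero term has more than [n] of them, so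
    the exponent does not depend on the length of [l]. *)
Lemma unipotent_power_growth (l bs : seq 'M[R]_n) :
    (forall y, y \in l -> S y) -> (forall a, a \in bs ->
      exists2 g, S g & a = g - 1) ->
  exists2 C : R, 0 <= C & forall m i j,
    `|((\prod_(a <- bs) a) * (\prod_(y <- l) y ^+ m)) i j| <= C * m.+1%:R ^+
      (n.+1 - size bs).
Proof.
elim: l bs => [|y l IH] bs lS bsS.
  exists (\sum_i \sum_j `|(\prod_(a <- bs) a) i j|);
    first by rewrite !sumr_ge0 // => i _; rewrite sumr_ge0.
  move=> m i j; rewrite big_nil mulr1.
  have C1 : `|(\prod_(a <- bs) a) i j| <= \sum_i \sum_j `|(\prod_(a <- bs) a) i
    j|.
    rewrite (bigD1 i) //= (bigD1 j) //= -addrA lerDl addr_ge0 //;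
      first by rewrite sumr_ge0.
    by rewrite sumr_ge0 // => k _; rewrite sumr_ge0.
  apply: le_trans C1 _; rewrite ler_peMr ?exprn_ege1 ?ler1n //.
  by rewrite sumr_ge0 // => k _; rewrite sumr_ge0.
have Sy : S y by apply: lS; rewrite mem_head.
have bsi i a : a \in bs ++ nseq i (y - 1) -> exists2 g, S g & a = g - 1.
  rewrite mem_cat => /orP[/bsS//|]; rewrite mem_nseq => /andP[_ /eqP ->].
  by exists y.
have lS' z : z \in l -> S z by move=> zl; apply: lS; rewrite inE zl orbT.
pose Ci i := s2val (cid2 (IH _ lS' (bsi i))).
have Ci0 i : 0 <= Ci i by rewrite /Ci; case: cid2.
have CiP i m j k : `|((\prod_(a <- bs ++ nseq i (y - 1)) a) * (\prod_(y <- l) y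
  ^+ m)) j k|
    <= Ci i * m.+1%:R ^+ (n.+1 - size (bs ++ nseq i (y - 1))).
  by rewrite /Ci; case: cid2 => C /= _; exact.
exists (\sum_(i < n.+1) Ci i); first by rewrite sumr_ge0.
move=> m j k; rewrite big_cons.
have yL : (y - 1) ^+ n.+1 = 0.
  have := prod_unipotent_monoid SM Suni (l := nseq n.+1 (y - 1)).
  rewrite big_nseq iter_mulr_1 size_nseq; apply => // a.
  by rewrite mem_nseq => /andP[_ /eqP ->]; exists y.
rewrite (expr_unipotent _ yL) mulr_suml mulr_sumr summxE mulr_suml.
apply: le_trans (ler_norm_sum _ _ _) _; apply: ler_sum => i _.
have -> : \prod_(a <- bs) a * ((y - 1) ^+ i *+ 'C(m,
  i) * \prod_(y <- l) y ^+ m) =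
    ((\prod_(a <- bs ++ nseq i (y - 1)) a) * (\prod_(y <- l) y ^+ m)) *+ 'C(m,
      i).
  by rewrite big_cat big_nseq iter_mulr_1 mulrnAl mulrnAr mulrA.
rewrite mulmxnE normrMn.
(* Terms with more than [n] factors vanish; in the others the [i] powers from the binomial
   coefficient make up for the [i] added to [size bs]. *)
have [le|gt] := leqP (size bs + i) n; last first.
  rewrite (prod_unipotent_monoid SM Suni (@bsi i));
    last by rewrite size_cat size_nseq.
  by rewrite mul0r mxE normr0 mul0rn mulr_ge0 // exprn_ge0.
rewrite -[_ *+ 'C(m, i)]mulr_natr.
have binR : ('C(m, i))%:R <= m.+1%:R ^+ i :> R.
  by rewrite -natrX ler_nat; exact: leq_bin_expn.
apply: (le_trans (ler_pM (normr_ge0 _) (ler0n _ _) (CiP i m j k) binR)).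
rewrite -mulrA -exprD size_cat size_nseq; apply: ler_wpM2l => //.
by rewrite (_ : (_ - _ + _)%N = (n.+1 - size bs)%N) //; lia.
Qed.

End Growth.

Definition prod_pow (G : groupType) (gs : seq G) (m : nat) : G :=
  foldr (fun g h => (g ^+ m * h)%g) 1%g gs.

Lemma prod_pow_cat (G : groupType) (gs hs : seq G) m :
  prod_pow (gs ++ hs) m = (prod_pow gs m * prod_pow hs m)%g.
Proof. by elim: gs => /= [|g gs ->]; rewrite ?mul1g ?mulgA. Qed.

(** Lets the inverse occurring in [rho_scale] be bounded like the element itself. *)
Lemma prod_powV (G : groupType) (gs : seq G) m :
  (prod_pow gs m)^-1%g = prod_pow (rev [seq g^-1%g | g <- gs]) m.
Proof.
elim: gs => /= [|g gs IH]; first by rewrite invg1.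
by rewrite rev_cons -cats1 prod_pow_cat -IH invgM /= mulg1 expVgn.
Qed.

Section ScaleGrowth.
Context (R : realType) (n : nat) (G : topologicalGroupType) (rho : G ->
  'M[R]_n).
Hypothesis rho1 : rho 1%g = 1%:M.
Hypothesis rhoM : forall x y, rho (x * y)%g = rho x *m rho y.

Lemma rho_prod_pow (gs : seq G) m :
  rho (prod_pow gs m) = \prod_(y <- [seq rho g | g <- gs]) y ^+ m.
Proof.
have rhoX g : rho (g ^+ m)%g = rho g ^+ m.
  by elim: m => [|m IH]; rewrite ?expg0 ?expr0 // expgS exprS rhoM IH.
by elim: gs => /= [|g gs IH]; rewrite ?big_nil // big_cons rhoM IH rhoX.
Qed.

Lemma rho_scale_le (h : G) (b : R) :
    (forall i j, `|rho h i j| <= b) -> (forall i j, `|rho h^-1%g i j| <= b) ->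
  rho_scale rho h <= 2 * n%:R ^+ 2 * b ^+ 2.
Proof.
have tr_le (A : 'M[R]_n) : (forall i j, `|A i j| <= b) ->
  \tr (A *m A^T) <= n%:R ^+ 2 * b ^+ 2.
  move=> Ab; apply: (@le_trans _ _ (\sum_(i < n) \sum_(j < n) b ^+ 2)).
    apply: ler_sum => i _; rewrite mxE; apply: ler_sum => j _;
      rewrite mxE -expr2.
    by rewrite -real_normK ?num_real // ler_pXn2r // nnegrE (le_trans _ (Ab i
      j)).
  by rewrite !sumr_const card_ord -mulrnA -[_ *+ _]mulr_natl natrM -expr2.
move=> hb hVb; rewrite /rho_scale -mulrA mulr_natl mulr2n.
by apply: lerD; exact: tr_le.
Qed.

Lemma rho_scale_ge0 (h : G) : 0 <= rho_scale rho h.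
Proof.
have tr_ge (A : 'M[R]_n) : 0 <= \tr (A *m A^T).
  by apply: sumr_ge0 => i _; rewrite mxE; apply: sumr_ge0 => j _;
    rewrite mxE -expr2 sqr_ge0.
by rewrite addr_ge0.
Qed.

Lemma scale_prod_pow_growth (s : G -> R) (N : set G) :
    algebraic_scale rho s -> is_subgroup N ->
    (forall x, N x -> exists k, (rho x - 1%:M) ^+ k = 0) ->
  exists D : nat, forall gs : seq G, (forall g, g \in gs -> N g) ->
    exists2 C : R, 0 <= C & forall m, s (prod_pow gs m) <= C * m.+1%:R ^+ D.
Proof.
move=> [_ [Cs [r sle]] _] [N1 NM NV] Nuni.
(* Matrix entries grow with exponent [n.+1], the trace form squares them, and the comparison of
   scales raises to the power [r]. The exponent is fixed before [gs]. *)
exists (n.+1 * 2 * r)%N => gs gsN.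
have SM g h : (rho @` N) g -> (rho @` N) h -> (rho @` N) (g *m h).
  by move=> [x Nx <-] [y Ny <-]; exists (x * y)%g; [exact: NM|exact: rhoM].
have Suni g : (rho @` N) g -> exists k, (g - 1) ^+ k = 0.
  by move=> [x Nx <-]; exact: Nuni.
have growth hs : (forall g, g \in hs -> N g) -> exists2 C : R, 0 <= C &
    forall m i j, `|rho (prod_pow hs m) i j| <= C * m.+1%:R ^+ n.+1.
  move=> hsN.
  have hsS y : y \in [seq rho h | h <- hs] -> (rho @` N) y.
    by move=> /mapP[h hhs ->]; exists h => //; exact: hsN.
  have [//|C C0 CP] := unipotent_power_growth SM Suni (bs := [::]) hsS.
  exists C => // m i j; have := CP m i j.
  by rewrite big_nil mul1r -rho_prod_pow subn0.
have [C1 C10 C1P] := growth _ gsN.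
have [|C2 C20 C2P] := growth (rev [seq g^-1%g | g <- gs]).
  by move=> g; rewrite mem_rev => /mapP[h hgs ->]; apply: NV; exact: gsN.
exists (`|Cs| * (2 * n%:R ^+ 2 * (C1 + C2) ^+ 2) ^+ r).
  by rewrite mulr_ge0 // exprn_ge0 // !mulr_ge0 // ?exprn_ge0 ?addr_ge0.
move=> m; set q : R := m.+1%:R.
have q00 : 0 <= q by exact: ler0n.
have q0 : 0 <= q ^+ n.+1 by rewrite exprn_ge0.
apply: le_trans (sle _) _; apply: le_trans (ler_norm _) _;
  rewrite normrM -[X in _ <= X]mulrA.
apply: ler_wpM2l => //;
  rewrite exprM -exprMn ger0_norm ?exprn_ge0 ?rho_scale_ge0 //.
apply: lerXn2r; rewrite ?nnegrE ?rho_scale_ge0 //.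
  by apply: mulr_ge0; rewrite ?exprn_ge0 // !mulr_ge0 ?exprn_ge0 ?addr_ge0
    ?ler0n.
rewrite [q ^+ _]exprM -[X in _ <= X]mulrA -exprMn; apply: rho_scale_le => i j.
  by apply: le_trans (C1P m i j) _; rewrite -/q ler_wpM2r // lerDl.
rewrite prod_powV.
by apply: le_trans (C2P m i j) _; rewrite -/q ler_wpM2r // lerDr.
Qed.

End ScaleGrowth.

(** * Iterated differences along powers of group elements *)

Section Differences.
Context (R : realType) (G : topologicalGroupType) (E : tvsType R[i]).
Context (act : G -> E -> E).
Hypothesis repE : continuous_representation act.

Definition diffs (gs : seq G) (m : nat) (v : E) : E :=
  foldr (fun g w => act (g ^+ m)%g w - w) v gs.

(** The expanded product is a signed sum of vectors [prod_pow hs m . v]. The induction carries a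
    prefix [hs] and splits the next factor [g^m - 1] into its two terms. *)
Lemma diffs_growth (p : E -> R) (D : nat) (N : set G) : continuous_seminorm p ->
    (forall (gs : seq G) v, (forall g, g \in gs -> N g) ->
      exists2 C : R, 0 <= C & forall m,
        p (act (prod_pow gs m) v) <= C * m.+1%:R ^+ D) ->
  forall gs v, (forall g, g \in gs -> N g) ->
    exists2 C : R, 0 <= C & forall m, p (diffs gs m v) <= C * m.+1%:R ^+ D.
Proof.
move=> sp pN gs v gsN; have [a1 aM _ _] := repE.
suff H hs : (forall g, g \in hs -> N g) ->
    exists2 C : R, 0 <= C & forall m,
      p (act (prod_pow hs m) (diffs gs m v)) <= C * m.+1%:R ^+ D.
  have [//|C C0 CP] := H [::]; exists C => // m.
  by have := CP m; rewrite /= a1.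
elim: gs hs gsN => [|g gs IH] hs gsN hsN; first exact: pN.
have gsN' h : h \in gs -> N h by move=> hgs; apply: gsN; rewrite inE hgs orbT.
have [C1 C10 C1P] := IH hs gsN' hsN.
have [|C2 C20 C2P] := IH (hs ++ [:: g]) gsN'.
  move=> h; rewrite mem_cat inE => /orP[/hsN//|/eqP ->]; apply: gsN;
    exact: mem_head.
exists (C2 + C1); first by rewrite addr_ge0.
move=> m; have := C2P m; rewrite prod_pow_cat /= mulg1 aM => h2.
have [_ _ pD _] := sp.
rewrite (actB repE); apply: le_trans (pD _ _) _;
  rewrite (seminormN _ sp) mulrDl.
by apply: lerD => //; exact: C1P.
Qed.

Lemma diffs_linear gs m (c : R[i]) u v :
  diffs gs m (c *: u + v) = c *: diffs gs m u + diffs gs m v.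
Proof.
have [_ _ L _] := repE; elim: gs => //= g gs ->.
by rewrite L scalerBr opprD addrACA.
Qed.

Lemma diffs_continuous gs m : continuous (diffs gs m).
Proof.
elim: gs => /= [|g gs IH] v; first exact: cvg_id.
apply: (@continuous_comp _ _ _ (diffs gs m) (fun w => act (g ^+ m)%g w - w));
  first exact: IH.
apply: (@continuous_comp _ _ _ (fun w =>
  (act (g ^+ m)%g w, w)) (fun x : E * E => x.1 - x.2)).
  by apply: cvg_pair; [exact: act_continuous|exact: cvg_id].
exact: sub_continuous.
Qed.

Lemma diffs_cat gs hs m v : diffs (gs ++ hs) m v = diffs gs m (diffs hs m v).
Proof. exact: foldr_cat. Qed.

Variables (T : set G) (V : nat -> set E).
Hypothesis TX : forall g m, T g -> T (g ^+ m)%g.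
Hypothesis V0 : forall v, V 0%N v.
Hypothesis V00 : forall k, V k 0.
Hypothesis VD : forall k u v, V k u -> V k v -> V k (u + v).
Hypothesis VZ : forall k (c : R[i]) v, V k v -> V k (c *: v).
Hypothesis VT : forall k g v, T g -> V k v -> V k.+1 (act g v - v).

(** Induction from [g^(m+1) - 1 = (g^m - 1) + (g - 1) + (g^m - 1)(g - 1)], whose last term raises
    the degree by two. *)
Lemma pow_sub1 k g m v : T g -> V k v ->
  V k.+2 (act (g ^+ m)%g v - v - (m%:R : R[i]) *: (act g v - v)).
Proof.
move=> Tg vk; have [a1 aM _ _] := repE; elim: m => [|m IH].
  by rewrite expg0 a1 scale0r subrr subr0.
have -> : act (g ^+ m.+1)%g v - v - (m.+1%:R : R[i]) *: (act g v - v) =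
    (act (g ^+ m)%g v - v - (m%:R : R[i]) *: (act g v - v)) +
    (act (g ^+ m)%g (act g v - v) - (act g v - v)).
  rewrite expgSr aM (actB repE) -natr1 scalerDl scale1r.
  rewrite [RHS]addrACA -[in RHS]opprD; congr (_ - _).
  by rewrite [RHS]addrC addrA subrK.
by apply: VD => //; apply: VT; [exact: TX|exact: VT].
Qed.

Lemma diffs_filtration gs m v : (forall g, g \in gs -> T g) ->
  V (size gs) (diffs gs m v).
Proof.
elim: gs => //= g gs IH gsT; apply: VT; first by apply: TX; apply: gsT;
  exact: mem_head.
by apply: IH => h hgs; apply: gsT; rewrite inE hgs orbT.
Qed.

(** If [w = m^J w1 + e] for the tail, then [(g^m - 1) w1] is [m (g - 1) w1] up to two degrees more
    by [pow_sub1], and [(g^m - 1) e] is one degree beyond [e]. *)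
Lemma diffs_leading gs m v : (forall g, g \in gs -> T g) ->
  V (size gs).+1 (diffs gs m v - (m%:R ^+ size gs : R[i]) *: diffs gs 1 v).
Proof.
elim: gs => [|g gs IH] gsT; first by rewrite /= expr0 scale1r subrr.
have Tg : T g by apply: gsT; exact: mem_head.
have gsT' h : h \in gs -> T h by move=> hgs; apply: gsT; rewrite inE hgs orbT.
set w1 := diffs gs 1 v; set w := diffs gs m v.
set e := w - (m%:R ^+ size gs : R[i]) *: w1.
have ek : V (size gs).+1 e by exact: IH.
have -> : diffs (g :: gs) m v - (m%:R ^+ size (g :: gs) : R[i]) *: diffs (g ::
  gs) 1 v =
   (m%:R ^+ size gs : R[i]) *:
     (act (g ^+ m)%g w1 - w1 - (m%:R : R[i]) *: (act g w1 - w1))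
   + (act (g ^+ m)%g e - e).
  rewrite /= -/w -/w1 expg1 [X in _ = X + _]scalerBr scalerA -exprSr.
  have -> : w = (m%:R ^+ size gs : R[i]) *: w1 + e by rewrite addrC subrK.
  have [_ _ L _] := repE.
  by rewrite [RHS]addrAC L; congr (_ - _); rewrite opprD addrACA -scalerBr.
apply: VD; last by apply: VT => //; exact: TX.
by apply: VZ; apply: pow_sub1 => //; exact: diffs_filtration.
Qed.

End Differences.

(** * Density of the filtration *)

Section SeminormClosure.
Context (R : realType) (E : tvsType R[i]).
Implicit Types (p : E -> R) (A : set E).

Definition seminorm_closure p A : set E :=
  [set v | forall e : R, 0 < e -> exists2 a, A a & p (v - a) < e].

Lemma sub_seminorm_closure p A : continuous_seminorm p ->
  A `<=` seminorm_closure p A.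
Proof. by move=> sp v Av e e0; exists v => //; rewrite subrr seminorm0. Qed.

Lemma seminorm_closure_closed p A v : continuous_seminorm p ->
    (forall e : R, 0 < e ->
      exists2 w, seminorm_closure p A w & p (v - w) < e) ->
  seminorm_closure p A v.
Proof.
move=> sp H e e0; have e20 : 0 < e / 2 by rewrite divr_gt0.
have [w /(_ _ e20)[a Aa wa] vw] := H _ e20.
by exists a => //; have := seminorm_triB w v a sp; lra.
Qed.

Lemma seminorm_closure_span p A : continuous_seminorm p ->
    A 0 -> (forall u v, A u -> A v -> A (u + v)) ->
    (forall (c : R[i]) v, A v -> A (c *: v)) ->
  [/\ seminorm_closure p A 0,
    forall u v, seminorm_closure p A u -> seminorm_closure p A v ->
      seminorm_closure p A (u + v)
    & forall (c : R[i]) v, seminorm_closure p A v ->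
      seminorm_closure p A (c *: v)].
Proof.
move=> sp A0 AD AZ; have [_ p0 pD pZ] := sp; split.
- exact: sub_seminorm_closure.
- move=> u v uA vA e e0; have e20 : 0 < e / 2 by rewrite divr_gt0.
  have [a Aa ua] := uA _ e20; have [b Ab vb] := vA _ e20.
  exists (a + b); first exact: AD.
  by have := pD (u - a) (v - b); rewrite addrACA -opprD; lra.
- move=> c v vA e e0; have c0 := normc_ge0 c.
  have [|a Aa va] := vA (e / (normc c + 1));
    first by rewrite divr_gt0 // ltr_wpDl.
  exists (c *: a); first exact: AZ.
  have ce : normc c * (e / (normc c + 1)) < e.
    have c1 : 0 < normc c + 1 by rewrite ltr_wpDl.
    by rewrite mulrCA gtr_pMr // ltr_pdivrMr // mul1r ltrDl.
  by rewrite -scalerBr pZ; apply: le_lt_trans ce; apply: ler_wpM2l => //;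
    exact: ltW.
Qed.

End SeminormClosure.

Section Density.
Context (R : realType) (n : nat) (G : topologicalGroupType) (rho : G ->
  'M[R]_n).
Context (E : tvsType R[i]) (act : G -> E -> E) (N : set G).
Hypothesis rhoc : continuous rho.
Hypothesis rho1 : rho 1%g = 1%:M.
Hypothesis rhoM : forall x y, rho (x * y)%g = rho x *m rho y.
Hypothesis repE : continuous_representation act.
Hypothesis smE : forall v, smooth_map rho (fun g => act g v).
Hypothesis NG : is_subgroup N.

Let W k : set E := lie_words act (lie_algebra N) k.
Let V k : set E := closure (lie_power act (lie_algebra N) k).
(** The exponentials of the Lie algebra of [N]: these are the elements covered by
    [lie_filtration_step], and their powers stay in the same one-parameter subgroup. *)
Let T : set G := [set g | exists gamma : R ->
  G, lie_algebra N gamma /\ exists t, g = gamma t].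

Let TX g m : T g -> T (g ^+ m)%g.
Proof.
move=> [gamma [Ng [t ->]]]; exists gamma; split => //; exists (m%:R * t).
have [_ gD _] := Ng; elim: m => [|m IH].
  by rewrite expg0 mul0r (lie_algebra0 Ng).
by rewrite expgS IH -gD -natr1 mulrDl mul1r addrC.
Qed.

Let TN g : T g -> N g.
Proof. by move=> [gamma [[_ _ gN] [t ->]]]. Qed.

Let V0 v : V 0%N v.
Proof. by apply: subset_closure; exact: sub_lspan. Qed.

Let V00 k : V k 0.
Proof. by apply: subset_closure; exact: lspan0. Qed.

Let VD k u v : V k u -> V k v -> V k (u + v).
Proof. exact: closureD. Qed.

Let VZ k (c : R[i]) v : V k v -> V k (c *: v).
Proof. exact: closureZ. Qed.

Let VT k g v : T g -> V k v -> V k.+1 (act g v - v).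
Proof. by move=> [gamma [Ng [t ->]]];
  apply: (lie_filtration_step (rho := rho)). Qed.

Variables (p : E -> R) (D : nat).
Hypothesis sp : continuous_seminorm p.
Hypothesis pN : forall (gs : seq G) v, (forall g, g \in gs -> N g) ->
  exists2 C : R, 0 <= C & forall m,
    p (act (prod_pow gs m) v) <= C * m.+1%:R ^+ D.

(* [m^J (g_1 - 1)...(g_J - 1)v] agrees with [(g_1^m - 1)...(g_J^m - 1)v] up to
   [V J.+1], while the latter only grows like [m^D] with [D < J]. *)
Lemma diffs_seminorm_closure J k gs v : (D < J)%N -> size gs = J ->
    (forall g, g \in gs -> T g) -> V J.+1 `<=` seminorm_closure p (V k) ->
  seminorm_closure p (V k) (diffs act gs 1 v).
Proof.
move=> DJ gsJ gsT VJ e e0; have [_ p0 pD pZ] := sp.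
have gsN g : g \in gs -> N g by move=> /gsT /TN.
have [C C0 CP] := diffs_growth repE sp pN v gsN.
(* Since [m + 1 <= 2 m], the quantity [b * m ^ D] bounds [p F + 1], where 1 accounts for the error
   term; [m] is then taken beyond [b / e]. *)
pose b := C * 2 ^+ D + 1.
have b0 : 0 < b by rewrite ltr_wpDl // mulr_ge0 // exprn_ge0.
pose m := Num.bound (b / e).
have mb : b / e < m%:R by rewrite archi_boundP // divr_ge0 // ltW.
have m0 : 0 < m%:R :> R by apply: lt_trans mb; rewrite divr_gt0.
have m1 : 1 <= m%:R :> R by rewrite ler1n; move: m0; rewrite ltr0n.
set x := diffs act gs 1 v; set F := diffs act gs m v.
have /VJ/(_ 1 ltr01)[a Va pa] : V J.+1 (F - (m%:R ^+ J : R[i]) *: x).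
  rewrite -gsJ; exact: (diffs_leading repE TX V0 V00 VD VZ VT).
have mE : (m%:R ^+ J : R[i]) = (m%:R ^+ J)%:C by rewrite rmorphXn rmorph_nat.
have mJ0 : 0 < m%:R ^+ J :> R by rewrite exprn_gt0.
(* [a] approximates the error [F - m^J x], so [x] is close to [- m^(-J) a], with distance at most
   [m^(-J) (p F + 1)]. *)
exists (- ((m%:R ^+ J)^-1%:C *: a)); first by rewrite -scaleN1r; apply: VZ;
  exact: VZ.
have -> : x - - ((m%:R ^+ J)^-1%:C *: a) =
    (m%:R ^+ J)^-1%:C *: (F - (F - (m%:R ^+ J : R[i]) *: x - a)).
  rewrite -[F - _ - a]addrA -opprD subKr opprK scalerDr mE scalerA -rmorphM /=.
  by rewrite mulVf ?gt_eqF // scale1r.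
rewrite (seminorm_real _ _ sp) ger0_norm ?invr_ge0 ?ltW // mulrC ltr_pdivrMr //.
apply: le_lt_trans (pD _ _) _; rewrite (seminormN _ sp).
have FC : p F <= C * 2 ^+ D * m%:R ^+ D.
  apply: le_trans (CP m) _; rewrite -mulrA -exprMn; apply: ler_wpM2l => //.
  by apply: lerXn2r; rewrite ?nnegrE ?mulr_ge0 // -natr1; lra.
have mD : 1 <= m%:R ^+ D :> R by rewrite exprn_ege1.
apply: (@lt_le_trans _ _ (b * m%:R ^+ D)); first by rewrite /b mulrDl mul1r;
  lra.
have -> : m%:R ^+ J = m%:R * (m%:R ^+ (J - D.+1) * m%:R ^+ D) :> R.
  by rewrite -exprD -exprS; congr (_ ^+ _); lia.
rewrite [e * _]mulrA; apply: ler_pM;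
  [exact: ltW|by rewrite exprn_ge0 // ltW| |].
  by rewrite [e * _]mulrC -ler_pdivrMr // ltW.
by rewrite ler_peMl ?exprn_ge0 ?exprn_ege1 // ltW.
Qed.

(** The outermost letter of the word is a limit of quotients [(gamma t - 1) / t], hence can be
    traded for a group element appended to [gs]. The total [i + size gs = J] is preserved until only
    an iterated difference remains. *)
Lemma words_seminorm_closure J k i gs w : (D < J)%N -> (i + size gs)%N = J ->
    (forall g, g \in gs -> T g) -> V J.+1 `<=` seminorm_closure p (V k) ->
    W i w -> seminorm_closure p (V k) (diffs act gs 1 w).
Proof.
move=> DJ + + VJ.
have [Z0 ZD ZZ] := @seminorm_closure_span R E p (V k) sp (V00 k) (@VD k) (@VZ
  k).
elim: i gs w => [|i IH] gs w /=.
  by rewrite add0n => gsJ gsT _; exact: diffs_seminorm_closure DJ gsJ gsT VJ.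
move=> gsJ gsT [gamma [v [Ng Wv vw]]].
apply: seminorm_closure_closed => // e e0.
have lim : diffs act gs 1 ((t^-1)%:C *: (act (gamma t) v - v)) @[t --> (0 :
  R)^'] --> diffs act gs 1 w.
  exact: cvg_comp _ _ vw (@diffs_continuous _ _ _ _ repE gs 1%N w).
have [t /= te] := filter_ex (cvg_seminorm_lt _ lim sp e0).
exists (diffs act gs 1 ((t^-1)%:C *: (act (gamma t) v - v)));
  last by rewrite (seminormB _ _ sp).
have dZ c u : diffs act gs 1 (c *: u) = c *: diffs act gs 1 u.
  have := diffs_linear repE gs 1 c u 0; rewrite addr0 => ->.
  have := diffs_linear repE gs 1 (-1) 0 0;
    rewrite scaler0 addr0 scaleN1r addNr => ->.
  by rewrite addr0.
rewrite dZ; apply: (ZZ).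
have -> : diffs act gs 1 (act (gamma t) v - v) = diffs act (gs ++ [:: gamma t])
  1 v.
  by rewrite diffs_cat /= expg1.
apply: IH => //; first by rewrite size_cat addn1 addnS -addSn.
move=> g; rewrite mem_cat inE => /orP[/gsT//|/eqP ->].
by exists gamma; split => //; exists t.
Qed.

(** Downward induction on [J] from [k], where the inclusion is trivial, to [D.+1]; each step passes
    from the words of length [J] to their closed span. *)
Lemma lie_filtration_dense k : V D.+1 `<=` seminorm_closure p (V k).
Proof.
have decr i j : (i <= j)%N -> V j `<=` V i.
  move=> /subnK <-; elim: (j - i)%N => [//|d IH].
  by rewrite addSn; apply: subset_trans IH; exact: lie_filtration_decr.
have step J : (D < J)%N -> V J.+1 `<=` seminorm_closure p (V k) ->
  V J `<=` seminorm_closure p (V k).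
  move=> DJ VJ v vJ; apply: seminorm_closure_closed => // e e0.
  have [a [m [c [w [Ww ->]]]] va] := closureP sp e0 vJ.
  exists (\sum_i c i *: w i) => //.
  have [Z0 ZD ZZ] := @seminorm_closure_span R E p (V k) sp (V00 k) (@VD k) (@VZ
    k).
  elim/big_ind: _ => // i _; apply: (ZZ).
  by apply: (@words_seminorm_closure J k J [::]) => //; rewrite addn0.
have [kD|Dk] := leqP k D.+1.
  by apply: subset_trans (decr _ _ kD) _; exact: sub_seminorm_closure.
suff H d j : (j + d)%N = k -> (D < j)%N -> V j `<=` seminorm_closure p (V k).
  by apply: (H (k - D.+1)%N) => //; rewrite subnKC // ltnW.
elim: d j => [|d IH] j; first by rewrite addn0 => -> _;
  exact: sub_seminorm_closure.
by move=> jd Dj; apply: step => //; apply: IH;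
  [rewrite addSn -addnS|exact: ltnW].
Qed.

End Density.

(** * A Mittag-Leffler argument in a Fréchet space *)

Section MittagLeffler.
Context (R : realType) (E : tvsType R[i]).

Lemma continuous_seminormD (p q : E -> R) : continuous_seminorm p ->
  continuous_seminorm q -> continuous_seminorm (fun v => p v + q v).
Proof.
move=> [pc p0 pD pZ] [qc q0 qD qZ]; split.
- by move=> v; apply: cvgD; [exact: pc|exact: qc].
- by move=> v; rewrite addr_ge0.
- by move=> u v; rewrite addrACA lerD.
- by move=> c v; rewrite pZ qZ mulrDr.
Qed.

(** Partial sums of [p] and of seminorms attached to a countable base of neighbourhoods of 0. *)
Lemma frechet_seminorms (p : E -> R) : frechet E -> continuous_seminorm p ->
  exists P : nat -> E -> R, [/\ forall i, continuous_seminorm (P i),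
    forall v, p v <= P 0%N v,
    forall i j v, (i <= j)%N -> P i v <= P j v
    & forall U, nbhs 0 U -> exists i, [set v | P i v < 1] `<=` U].
Proof.
move=> [_ [B [B0 Bbase]] _] sp.
pose q i := s2val (cid2 (nbhs0_seminorm (B0 i))).
have sq i : continuous_seminorm (q i) by rewrite /q; case: cid2.
have qB i : [set v | q i v < 1] `<=` B i by rewrite /q; case: cid2.
pose fix P i {struct i} : E -> R :=
  if i is j.+1 then fun v => P j v + q i v else fun v => p v + q 0%N v.
have sP i : continuous_seminorm (P i).
  by elim: i => [|i IH] /=; exact: continuous_seminormD.
have q0 i v : 0 <= q i v by have [_ + _ _] := sq i; exact.
have Pmono i j v : (i <= j)%N -> P i v <= P j v.
  move=> /subnK <-; elim: (j - i)%N => [//|d IH].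
  by rewrite addSn /=; apply: le_trans IH _; rewrite lerDl.
have qP i v : q i v <= P i v.
  have [_ p0 _ _] := sp; case: i => [|i] /=; first by rewrite lerDr.
  by have [_ + _ _] := sP i; rewrite lerDr.
exists P; split => //; first by move=> v /=; rewrite lerDl.
move=> U /Bbase[i BU]; exists i => v Pv; apply: BU; apply: qB.
exact: le_lt_trans (qP i v) Pv.
Qed.

(** Starting from [v], successive approximations [u i] in [V (K i)] move by at most [2^-(i+2)] for
    [P i]. They converge by completeness, and the limit lies in every closed [V k]. *)
Lemma mittag_leffler (V : nat -> set E) (p : E -> R) : frechet E ->
    (forall k, closed (V k)) -> (forall k, V k.+1 `<=` V k) ->
    (forall q, continuous_seminorm q -> exists K, forall k,
      V K `<=` seminorm_closure q (V k)) ->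
    continuous_seminorm p ->
  exists K, forall v, V K v -> exists2 c, (forall k, V k c) & p (v - c) < 1.
Proof.
move=> fE Vc Vdec dens sp; have [_ _ complete] := fE.
have [P [sP pP Pmono Pbase]] := frechet_seminorms fE sp.
have decr i j : (i <= j)%N -> V j `<=` V i.
  move=> /subnK <-; elim: (j - i)%N => [//|d IH].
  by rewrite addSn; apply: subset_trans IH; exact: Vdec.
(* Adding [i] makes [K i >= i], so that [u i] eventually enters every [V k]. *)
pose K i := (sval (cid (dens _ (sP i))) + i)%N.
have KP i k : V (K i) `<=` seminorm_closure (P i) (V k).
  by apply: subset_trans (decr _ _ (leq_addr _ _)) _; case: cid => K' /=; exact.
exists (K 0%N) => v Kv.
pose h i : R := 2^-1 ^+ i.
have h0 i : 0 < h i by rewrite exprn_gt0 // invr_gt0.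
have hS i : h i = 2 * h i.+1 by rewrite /h exprS mulrA mulfV ?mul1r.
have next i w : exists w', V (K i) w -> V (K i.+1) w' /\ P i (w - w') < h i.+2.
  have [Vw|] := pselect (V (K i) w); last by exists 0.
  by have [w' Vw' ww'] := KP i (K i.+1) w Vw (h i.+2) (h0 _); exists w'.
pose nxt i w := sval (cid (next i w)).
pose fix u i {struct i} := if i is j.+1 then nxt j (u j) else v.
have uV i : V (K i) (u i).
  elim: i => [//|i IH] /=; rewrite /nxt; case: cid => w' /= /(_ IH)[]//.
have uS i : P i (u i - u i.+1) < h i.+2.
  by rewrite /= /nxt; case: cid => w' /= /(_ (uV i))[].
have PD i x y : P i (x + y) <= P i x + P i y by have [_ _ + _] := sP i; exact.
(* The steps telescope, since [h i.+2 = h i.+1 - h i.+2]. *)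
have ud i a d : (i <= a)%N -> P i (u a - u (a + d)%N) <= h a.+1 - h (a + d).+1.
  move=> ia; elim: d => [|d IH]; first by rewrite addn0 !subrr seminorm0.
  have := seminorm_triB (u (a + d)%N) (u a) (u (a + d.+1)%N) (sP i).
  have := le_lt_trans (Pmono i (a + d)%N _ (leq_trans ia (leq_addr _ _))) (uS
    (a + d)%N).
  have := hS (a + d).+1; rewrite addnS; lra.
have uC i a b : (i <= a)%N -> (i <= b)%N -> P i (u a - u b) < h i.
  have main a' b' : (i <= a')%N -> (a' <= b')%N -> P i (u a' - u b') < h i.
    move=> ia ab; have := ud i a' (b' - a')%N ia; rewrite subnKC //.
    have : h a'.+1 < h i.
      by rewrite /h ltr_iXn2l ?invr_gt0 ?invf_lt1 ?ltr1n.
    by have := h0 b'.+1; lra.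
  move=> ia ib; have [ab|/ltnW ba] := leqP a b; first exact: main.
  by rewrite (seminormB _ _ (sP i)); exact: main.
have [l ul] : exists l : E, u @ \oo --> l.
  apply: complete => U /Pbase[i PU].
  exists ([set a | (i <= a)%N], [set b | (i <= b)%N]).
    by split; exists i.
  move=> [a b] /= [ia ib]; apply: PU => /=.
  by apply: lt_le_trans (uC i a b ia ib) _;
    rewrite /h exprn_ile1 ?invr_ge0 ?invf_le1 ?ler1n.
exists l.
  move=> k; apply: (Vc k) => U /ul [j /= _ jU].
  exists (u (maxn j k)); split; last by apply: jU; exact: leq_maxl.
  apply: (decr _ (K (maxn j k))) => //.
  by rewrite (leq_trans (leq_maxr j k)) // leq_addl.
have h12 : h 1%N = 2^-1 by rewrite /h expr1.
have near_l := cvg_seminorm_lt _ ul sp (h0 1%N).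
have [j /= ulj] := filter_ex (near_l _).
(* The distance from [v] to [u j] is below 1/2, and so is the one from [u j] to [l]. *)
have := ud 0%N 0%N j (leq0n 0); rewrite add0n /= => vj.
have := seminorm_triB (u j) v l sp; have := pP (v - u j); have := h0 j.+1.
by rewrite h12 in vj ulj *; lra.
Qed.

End MittagLeffler.

(** * Convergence in the quotient *)

Theorem proposition1p1 (R : realType) (n : nat) (G : topologicalGroupType)
    (rho : G -> 'M[R]_n) (Grho : real_reductive rho)
    (s : G -> R) (sG : algebraic_scale rho s)
    (E : tvsType R[i]) (act : G -> E -> E)
    (piE : smooth_frechet_representation act rho s)
    (P N : set G) (parP : parabolic_subgroup rho P) (NP : unipotent_radical rho P N)
    (x : nat -> CJ_quotient act N)
    (xk : forall k, (1 <= k)%N ->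
      [set CJ_pi act N v | v in closure (lie_power act (lie_algebra N) k)] (x k)) :
  x @ \oo --> CJ_pi act N 0.
Proof.
have [_ rhoc [rho1 rhoM] _ _] := Grho.
have [fE repE smE growthE] := piE.
have [[NG _ _ _ [_ Nuni]] _] := NP.
pose V k : set E := closure (lie_power act (lie_algebra N) k).
have [D DP] := scale_prod_pow_growth rho1 rhoM sG NG Nuni.
have dens q : continuous_seminorm q ->
  exists K, forall k, V K `<=` seminorm_closure q (V k).
  move=> sq; have [r [p2 [[_ p20 _ _] qp2]]] := growthE q sq.
  (* Moderate growth raises the scale to the power [r], so the exponent becomes [D * r], still
     independent of the number of factors. *)
  exists (D * r).+1 => k;
    apply: (lie_filtration_dense rhoc rho1 rhoM repE smE NG sq).
  move=> gs v gsN; have [C C0 CP] := DP gs gsN.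
  exists (C ^+ r * p2 v); first by rewrite mulr_ge0 // exprn_ge0.
  move=> m; apply: le_trans (qp2 _ _) _; rewrite mulrAC; apply: ler_wpM2r => //.
  rewrite exprM -exprMn; have [s0 _ _] := sG.
  by apply: lerXn2r => //; rewrite nnegrE ?mulr_ge0 // exprn_ge0.
move=> O; rewrite nbhsE => -[B [Bo B0] BO].
have nbO : nbhs (0 : E) [set v | B (CJ_pi act N v)].
  by apply: open_nbhs_nbhs; split.
have [p sp pO] := nbhs0_seminorm nbO.
have [K KP] := mittag_leffler (V := V) fE (fun k => closed_closure (A := _))
  (fun k => @lie_filtration_decr R G E act N k) dens sp.
(* [K.+1] also ensures [1 <= k], as [xk] requires. *)
exists K.+1 => // k /= Kk; apply: BO.
have [v vk <-] := xk k (leq_trans (ltn0Sn K) Kk).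
have vK : V K v.
  move: vk; rewrite -(subnK (ltnW Kk)); elim: (k - K)%N => [//|d IH].
  by rewrite addSn => /lie_filtration_decr.
have [c cV pvc] := KP v vK.
(* Subtracting [c], which lies in the intersection, keeps the class and brings the representative
   into the unit ball of [p]. *)
have -> : CJ_pi act N v = CJ_pi act N (v - c).
  have cN : v - (v - c) \in CJ_pred act N.
    by rewrite subKr; apply/asboolP => j _; exact: cV.
  by move: cN; rewrite Quotient.idealrBE => /eqP.
exact: pO pvc.
Qed.
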